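(* Let $F,G:\mathbb R^n\to[0,\infty)$ be locally Lipschitz, even and $p$-homogeneous functions. Suppose that $G$ is positive on $\mathbb R^n\setminus\{0\}$ and convex, that $\Pi:=\{x\neq 0:F(x)/G(x)=0\}\cup\{0\}$ is a linear subspace, and that $F(x+y)=F(x)$ for all $y\in\Pi$ and all $x\in\mathbb R^n$. Then $$\min_{x\in\Pi^\perp\setminus\{0\}}\ \max_{y\in\Pi}\frac{F(x+y)}{G(x+y)}=\min_{x\in\Pi^\perp\setminus\{0\}}\frac{F(x)}{\min_{y\in\Pi}G(x+y)}=\min_{x\ne0:\ \nabla G(x)\cap\Pi^\perp\ne\varnothing}\frac{F(x)}{G(x)}=\lambda_{\dim\Pi+1},$$ and this number is the second smallest eigenvalue of $(F,G)$ (the first non-trivial eigenvalue, where the multiplicity of the first eigenvalue is not counted).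
   Context: $F$ is $p$-homogeneous if $F(tx)=t^pF(x)$ for all $x\in\mathbb R^n$ and $t>0$. $\Pi^\perp$ is the orthogonal complement of $\Pi$. $\nabla$ denotes the Clarke subdifferential (for convex $G$, the convex subdifferential). $\lambda\in\mathbb R$ is an eigenvalue of $(F,G)$ if there is $x\ne0$ with $\nabla F(x)\cap\lambda\nabla G(x)\ne\varnothing$. $\lambda_k=\inf_{A}\sup_{x\in A}F(x)/G(x)$ is the $k$-th min-max eigenvalue, where $A$ ranges over compact symmetric ($-A=A$) subsets of $\mathbb R^n\setminus\{0\}$ of Krasnoselskii $\mathbb Z_2$-genus at least $k$; the genus of a nonempty such set $A$ is the least $s\ge1$ such that there is an odd continuous map $A\to\mathbb S^{s-1}$.
   Formalization: Assumes p>0 (for p=0 every real is an eigenvalue) and Π≠R^n (else the minima are over empty sets); the number is always shown to be the smallest nonzero eigenvalue, but the second smallest only if Π≠{0}, since for Π={0} it is the smallest. *)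

(* Defs.v *)
From HB Require Import structures.
From mathcomp Require Export all_boot all_order all_algebra.
From mathcomp Require Export all_classical all_reals all_analysis.

Set Implicit Arguments.
Unset Strict Implicit.
Unset Printing Implicit Defensive.

Import Order.TTheory GRing.Theory Num.Theory.
Import numFieldNormedType.Exports.

Local Open Scope classical_set_scope.
Local Open Scope ring_scope.

Definition is_minimum (R : realType) (A : set R) (m : R) := A m /\ lbound A m.
Definition is_maximum (R : realType) (A : set R) (m : R) := A m /\ ubound A m.

(* The second smallest element of A as a set, so multiplicities play no role. *)
Definition is_second_minimum (R : realType) (A : set R) (m : R) :=
  exists2 m1, is_minimum A m1 & is_minimum (A `\ m1) m.

Definition dotv (R : realType) (n : nat) (x y : 'rV[R]_n) : R :=
  \sum_(i < n) x 0 i * y 0 i.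

Definition ortho_compl (R : realType) (n : nat) (U : {vspace 'rV[R]_n}) :
    set 'rV[R]_n :=
  [set x | forall y, y \in U -> dotv x y = 0].

(* The library norm on 'rV[R]_n is the sup norm; local Lipschitz continuity does
   not depend on the choice of a norm. *)
Definition locally_lipschitz (R : realType) (n : nat) (F : 'rV[R]_n -> R) :=
  forall x : 'rV[R]_n, exists2 U, nbhs x U & [lipschitz (F y : R^o) | y in U].

Definition homogeneous (R : realType) (n : nat) (p : R) (F : 'rV[R]_n -> R) :=
  forall (x : 'rV[R]_n) (t : R), 0 < t -> F (t *: x) = t `^ p * F x.

(* F°(x; v) = limsup_{y -> x, t -> 0+} (F (y + t v) - F y) / t *)
Definition clarke_derivative (R : realType) (n : nat) (F : 'rV[R]_n -> R)
    (x v : 'rV[R]_n) : \bar R :=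
  limf_esup (fun z : 'rV[R]_n * R => ((F (z.1 + z.2 *: v) - F z.1) / z.2)%:E)
    (filter_prod (nbhs x) (at_right (0 : R))).

(* For convex F this is the subdifferential of convex analysis. *)
Definition subdiff (R : realType) (n : nat) (F : 'rV[R]_n -> R)
    (x : 'rV[R]_n) : set 'rV[R]_n :=
  [set xi | forall v, ((dotv xi v)%:E <= clarke_derivative F x v)%E].

Definition spectrum (R : realType) (n : nat) (F G : 'rV[R]_n -> R) : set R :=
  [set mu | exists2 x : 'rV[R]_n, x != 0 &
     subdiff F x `&` [set mu *: eta | eta in subdiff G x] !=set0].

(* There is an odd continuous map from A to the Euclidean unit sphere of R^s. *)
Definition odd_map_to_sphere (R : realType) (n : nat) (A : set 'rV[R]_n)
    (s : nat) :=
  exists f : 'rV[R]_n -> 'rV[R]_s,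
    [/\ {within A, continuous f},
        forall x, A x -> f (- x) = - f x &
        forall x, A x -> dotv (f x) (f x) = 1].

Definition is_genus (R : realType) (n : nat) (A : set 'rV[R]_n) (s : nat) :=
  [/\ (1 <= s)%N, odd_map_to_sphere A s &
      forall t, (1 <= t)%N -> odd_map_to_sphere A t -> (s <= t)%N].

Definition genus_family (R : realType) (n k : nat) : set (set 'rV[R]_n) :=
  [set A : set 'rV[R]_n | [/\ A !=set0, compact A, [set - x | x in A] = A, ~ A 0 &
               exists2 s, is_genus A s & (k <= s)%N]].

Definition minmax_eigenvalue (R : realType) (n : nat) (F G : 'rV[R]_n -> R)
    (k : nat) : \bar R :=
  ereal_inf [set ereal_sup [set (F x / G x)%:E | x in A]
            | A in @genus_family R n k].

(* Main.v *)
Require Import Defs.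
From mathcomp Require Import all_boot all_order all_algebra.
From mathcomp Require Import finmap ring lra.
From mathcomp Require Import all_classical all_reals all_analysis.
Import Order.TTheory GRing.Theory Num.Theory.
Import numFieldNormedType.Exports.
Local Open Scope classical_set_scope.
Local Open Scope ring_scope.

(** All the numbers in question are the minimum [lambda] of [F / G] over the
    nonzero points [z] that minimise [G] on their coset [z + Pi] ([coset_min]).

    Such points exist in every coset, because [G] is convex, continuous and
    positive away from 0, and the minimum of [F / G] over them is attained by
    homogeneity and compactness ([quotient_min_exists]).  As [F] is constant on
    cosets, the maximum of [F / G] over a coset is the value at a minimiser of
    [G], which gives the first two formulas.

    A point [z] minimises [G] on its coset exactly when [G] has a subgradient
    [xi] at [z] orthogonal to [Pi]; the nontrivial direction takes a subgradient
    of the marginal function, the minimum of [G] over cosets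
    ([coset_min_subgradient]).  This is the third formula.  At the optimal [z]
    the affine function with slope [lambda xi] touches [F] at [z] from below, so
    [lambda xi] lies in the Clarke subdifferential of [F] and [lambda] is an
    eigenvalue.  Conversely, if [xi = mu eta] with [mu] nonzero, [xi] in the
    subdifferential of [F] at [x] and [eta] in that of [G], then [xi] and hence
    [eta] are orthogonal to [Pi] by the invariance of [F], so [x] is coset
    minimal, and Euler's identity for Clarke subgradients ([subdiff_euler])
    gives [mu = F x / G x], which is at least [lambda].

    For the min-max value, a set of genus greater than the dimension of [Pi]
    contains a coset minimal point, since otherwise descent directions of [G]
    along [Pi], glued by a partition of unity, would be an odd map from the set
    to [Pi] without zeros ([genus_family_coset_min]).  Conversely the span of
    [z] and [Pi] contains a compact symmetric set of genus at least
    [\dim Pi + 1], on which [F / G <= lambda] ([genus_family_span]).  That genus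
    bound is the Borsuk-Ulam theorem ([borsuk_ulam]).  It is derived from Ky
    Fan's lemma, a parity count of the simplices with alternating labels in
    nested hemispheres ([fan_parity]).  The triangulations are chains modulo 2
    of vertex sequences, obtained from the cross-polytope by iterated
    barycentric subdivision; only their boundary relations and the size of
    their simplices matter. *)

Set Implicit Arguments.
Unset Strict Implicit.
Unset Printing Implicit Defensive.

(** * Simplicial chains modulo 2 *)

Section Chains.
Local Open Scope nat_scope.
Variable T : eqType.
Implicit Types (s : seq T) (c : seq (seq T)) (phi psi : seq T -> bool).

Fixpoint faces s : seq (seq T) :=
  if s is x :: s' then s' :: map (cons x) (faces s') else [::].

Definition boundary c := flatten (map faces c).

(** A simplex is the sequence of its vertices, and a chain with coefficients in
    Z/2 is a sequence of simplices read up to cancellation of equal pairs.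
    Chains are never normalised: two of them count as equal when all cochains
    [phi] take the same value on them, so every chain identity below is an
    identity between pairings. *)
Definition pairing phi c := \big[addb/false]_(s <- c) phi s.

Definition coboundary phi s := pairing phi (faces s).

Lemma pairing_cons phi s c : pairing phi (s :: c) = phi s (+) pairing phi c.
Proof. by rewrite /pairing big_cons. Qed.

Lemma pairing_cat phi c1 c2 :
  pairing phi (c1 ++ c2) = pairing phi c1 (+) pairing phi c2.
Proof. by rewrite /pairing big_cat. Qed.

Lemma pairing_map phi (f : seq T -> seq T) c :
  pairing phi (map f c) = pairing (phi \o f) c.
Proof. by rewrite /pairing big_map. Qed.

Lemma pairing_flatten phi (f : seq T -> seq (seq T)) c :
  pairing phi (flatten (map f c)) = pairing (fun s => pairing phi (f s)) c.
Proof. by rewrite /pairing big_flatten big_map. Qed.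

Lemma pairingD phi psi c :
  pairing (fun s => phi s (+) psi s) c = pairing phi c (+) pairing psi c.
Proof. by rewrite /pairing big_split. Qed.

Lemma eq_pairing phi psi c :
  {in c, phi =1 psi} -> pairing phi c = pairing psi c.
Proof. exact: eq_big_seq. Qed.

Lemma pairing0 phi c : {in c, forall s, phi s = false} -> pairing phi c = false.
Proof. by move=> phi0; rewrite (eq_pairing phi0) /pairing big1. Qed.

Lemma pairing_boundary phi c :
  pairing phi (boundary c) = pairing (coboundary phi) c.
Proof. exact: pairing_flatten. Qed.

Lemma coboundary_cons phi x s :
  coboundary phi (x :: s) = phi s (+) coboundary (phi \o cons x) s.
Proof. by rewrite /coboundary /= pairing_cons pairing_map. Qed.

(** The identity d d = 0, by peeling off the first vertex: the face opposite to
    it occurs twice. *)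
Lemma coboundary_coboundary phi s : coboundary (coboundary phi) s = false.
Proof.
elim: s phi => [|x s IHs] phi; first by rewrite /coboundary /pairing big_nil.
rewrite coboundary_cons.
have -> : coboundary (coboundary phi \o cons x) s =
    coboundary phi s (+) coboundary (coboundary (phi \o cons x)) s.
  rewrite /(coboundary _ s) -pairingD; apply: eq_pairing => t _ /=.
  exact: coboundary_cons.
by rewrite IHs addbF addbb.
Qed.

(** The boundary of a cone is its base plus the cone over the boundary of the
    base; with the empty simplex counted as a face this holds in all
    dimensions. *)
Lemma pairing_boundary_cone phi x c :
  pairing phi (boundary (map (cons x) c)) =
  pairing phi c (+) pairing (phi \o cons x) (boundary c).
Proof.
rewrite !pairing_boundary pairing_map -pairingD.
by apply: eq_pairing => s _ /=; rewrite coboundary_cons.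
Qed.

Lemma size_faces n s t : size s = n.+1 -> t \in faces s -> size t = n.
Proof.
elim: s n t => [//|x s IHs] n t [sn]; rewrite inE => /predU1P[->//|].
case: n sn => [/size0nil->//|n] sn /mapP[u us ->] /=.
by rewrite (IHs n).
Qed.

Lemma face_subset s t : t \in faces s -> {subset t <= s}.
Proof.
elim: s t => [//|x s IHs] t; rewrite inE => /predU1P[->|].
  by move=> y ys; rewrite inE ys orbT.
move=> /mapP[u us ->] y; rewrite !inE => /orP[->//|yu].
by rewrite (IHs u us) ?orbT.
Qed.

Lemma faces_subseq s t : t \in faces s -> subseq t s.
Proof.
elim: s t => [//|x s IHs] t; rewrite inE => /predU1P[->|].
  exact: subseq_cons.
by move=> /mapP[u us ->] /=; rewrite eqxx; exact: IHs.
Qed.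

(** For a cochain that ignores the order of the vertices, the sum over the faces
    is a sum over the vertices, and hence ignores the order as well. *)
Lemma coboundary_rem phi s :
    (forall s1 s2, perm_eq s1 s2 -> phi s1 = phi s2) ->
  coboundary phi s = \big[addb/false]_(x <- s) phi (rem x s).
Proof.
elim: s phi => [|x s IHs] phi phi_perm.
  by rewrite big_nil /coboundary /pairing big_nil.
rewrite coboundary_cons big_cons /= eqxx; congr (_ (+) _).
rewrite IHs => [|s1 s2 s12]; last by apply: phi_perm; rewrite perm_cons.
apply: eq_big_seq => y ys /=; apply: phi_perm; case: eqP => [->|_] //.
by rewrite perm_sym perm_to_rem.
Qed.

Lemma coboundary_perm phi s1 s2 :
    (forall t1 t2, perm_eq t1 t2 -> phi t1 = phi t2) ->
  perm_eq s1 s2 -> coboundary phi s1 = coboundary phi s2.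
Proof.
move=> phi_perm s12; rewrite !coboundary_rem // (perm_big _ s12).
apply: eq_bigr => x _; apply: phi_perm; apply/permP => a.
by rewrite !count_rem (permP s12) (perm_mem s12).
Qed.

Section Subdivision.
Variable bary : seq T -> T.

(** Barycentric subdivision of a simplex with [n] vertices.  It is a chain map
    whatever the point chosen by [bary]. *)
Fixpoint sd n s : seq (seq T) :=
  if n is n'.+1 then map (cons (bary s)) (flatten (map (sd n') (faces s)))
  else [:: [::]].

Definition subdivision n c := flatten (map (sd n) c).

(** Induction on the number of vertices: the boundary of the cone is the
    subdivided boundary plus a cone over the boundary of that chain, which by
    induction is the subdivision of a double boundary. *)
Lemma boundary_sd n s phi : size s = n.+1 ->
  pairing phi (boundary (sd n.+1 s)) = pairing phi (subdivision n (faces s)).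
Proof.
elim: n s phi => [|n IHn] s phi sn.
  case: s sn => [//|x [|//]] _ /=.
  by rewrite /boundary /subdivision /=.
rewrite -/(sd n.+2 s) [sd n.+2 s]/= -/(subdivision n.+1 (faces s)).
rewrite pairing_boundary_cone.
set psi := (X in pairing X (boundary _)).
suff -> : pairing psi (boundary (subdivision n.+1 (faces s))) = false.
  by rewrite addbF.
rewrite pairing_boundary pairing_flatten.
rewrite -(coboundary_coboundary (fun s => pairing psi (sd n s)) s).
apply: eq_pairing => t ts; rewrite -pairing_boundary IHn; last first.
  exact: size_faces sn ts.
exact: pairing_flatten.
Qed.

Lemma boundary_subdivision n c phi : {in c, forall s, size s = n.+1} ->
  pairing phi (boundary (subdivision n.+1 c)) =
  pairing phi (subdivision n (boundary c)).
Proof.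
move=> cn; rewrite pairing_boundary pairing_flatten [RHS]pairing_flatten.
rewrite pairing_boundary; apply: eq_pairing => s sc.
by rewrite -pairing_boundary boundary_sd ?cn // pairing_flatten.
Qed.

(** The recursion that produces the simplices of a subdivision, as an induction
    principle for properties relating a simplex to its pieces. *)
Lemma sd_ind (P : nat -> seq T -> seq T -> Prop) :
    (forall s, P 0 s [::]) ->
    (forall n s t u, size s = n.+1 -> t \in faces s -> u \in sd n t ->
       P n t u -> P n.+1 s (bary s :: u)) ->
  forall n s u, size s = n -> u \in sd n s -> P n s u.
Proof.
move=> P0 PS; elim=> [|n IHn] s u sn /=; first by rewrite inE => /eqP->.
move=> /mapP[v /flattenP[w /mapP[t ts ->] vw] ->].
by apply: (PS _ _ t) => //; apply: IHn => //; apply: size_faces ts.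
Qed.

Lemma size_sd n s u : size s = n -> u \in sd n s -> size u = n.
Proof.
move: n s u; apply: sd_ind => // n s t u _ _ _ /= -> //.
Qed.

Lemma size_subdivision n c : {in c, forall s, size s = n} ->
  {in subdivision n c, forall s, size s = n}.
Proof.
move=> cn u /flattenP[w /mapP[s sc ->]]; apply: size_sd; exact: cn.
Qed.

Lemma pairing_subdivision phi n c :
  pairing phi (subdivision n c) = pairing (fun s => pairing phi (sd n s)) c.
Proof. exact: pairing_flatten. Qed.

Variable nu : T -> T.
Hypothesis bary_nu : forall s, bary (map nu s) = nu (bary s).

Lemma faces_map s : faces (map nu s) = map (map nu) (faces s).
Proof. by elim: s => [//|x s IHs] /=; rewrite IHs -!map_comp. Qed.

Lemma sd_map n s : sd n (map nu s) = map (map nu) (sd n s).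
Proof.
elim: n s => [//|n IHn] s /=; rewrite bary_nu faces_map.
suff -> : flatten (map (sd n) (map (map nu) (faces s))) =
    map (map nu) (flatten (map (sd n) (faces s))).
  by rewrite -!map_comp; exact: eq_map.
rewrite map_flatten -!map_comp; congr flatten.
by apply: eq_map => t /=; rewrite IHn.
Qed.

End Subdivision.
End Chains.

(** * Ky Fan's parity argument *)

Section Labels.
Local Open Scope nat_scope.

(** A label stands for a nonzero integer: an index for its absolute value, and
    its sign. *)
Definition label := (nat * bool)%type.
Definition opp_label (l : label) : label := (l.1, ~~ l.2).
Definition label_le (l1 l2 : label) :=
  (l1.1 < l2.1) || (l1.1 == l2.1) && (l1.2 ==> l2.2).

Fixpoint alternating (b : bool) (L : seq label) :=
  if L is l :: L' then
    [&& l.2 == b, (if L' is l' :: _ then l.1 < l'.1 else true)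
      & alternating (~~ b) L']
  else true.

Definition fan b L := alternating b (sort label_le L).

(** No two labels are opposite. *)
Definition consistent (L : seq label) :=
  {in L &, forall l1 l2, l1.1 = l2.1 -> l1 = l2}.

Lemma label_le_total : total label_le.
Proof.
move=> [i a] [j b]; rewrite /label_le /=.
by case: ltngtP; case: a; case: b.
Qed.

Lemma label_le_trans : transitive label_le.
Proof.
move=> [i a] [j b] [k c]; rewrite /label_le /=.
move=> /orP[ji|/andP[/eqP-> ba]] /orP[ik|/andP[/eqP<- ac]].
- by rewrite (ltn_trans ji ik).
- by rewrite ji.
- by rewrite ik.
- rewrite eqxx orbC /=; apply/orP; left.
  by apply/implyP => /(implyP ba)/(implyP ac).
Qed.

Lemma label_le_anti : antisymmetric label_le.
Proof.
move=> [i a] [j b]; rewrite /label_le /=.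
by case: ltngtP => // ->; case: a; case: b.
Qed.

Lemma alternating_ltn b L :
  alternating b L -> sorted ltn (map fst L).
Proof.
elim: L b => [//|l [//|l' L] IHL] b /and3P[_ ll' aL] /=.
by rewrite ll'; exact: IHL aL.
Qed.

Lemma alternating_sorted b L : alternating b L -> sorted label_le L.
Proof.
elim: L b => [//|l [//|l' L] IHL] b /and3P[_ ll' aL] /=.
by rewrite {1}/label_le ll'; exact: IHL aL.
Qed.

(** An alternating sequence is strictly increasing, so sorting finds it whenever
    some rearrangement alternates. *)
Lemma fanP b L :
  reflect (exists2 L', perm_eq L' L & alternating b L') (fan b L).
Proof.
apply: (iffP idP) => [aL|[L' LL' aL']].
  by exists (sort label_le L) => //; rewrite perm_sort.
rewrite /fan -(perm_sortP label_le_total label_le_trans label_le_anti _ _ LL').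
by rewrite (sorted_sort label_le_trans) // (alternating_sorted aL').
Qed.

Lemma fan_perm b L1 L2 : perm_eq L1 L2 -> fan b L1 = fan b L2.
Proof.
move=> L12; rewrite /fan.
by rewrite (perm_sortP label_le_total label_le_trans label_le_anti _ _ L12).
Qed.

Lemma alternating_opp b L :
  alternating b (map opp_label L) = alternating (~~ b) L.
Proof.
elim: L b => [//|l L IHL] b /=; rewrite IHL; congr [&& _, _ & _].
  by rewrite /=; case: (l.2); case: b.
by case: L {IHL}.
Qed.

Lemma opp_labelK : involutive opp_label.
Proof. by case=> i a; rewrite /opp_label /= negbK. Qed.

Lemma fan_opp b L : fan b (map opp_label L) = fan (~~ b) L.
Proof.
apply/fanP/fanP => -[L' LL' aL'].
  exists (map opp_label L'); last by rewrite alternating_opp negbK.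
  by rewrite -[L](mapK opp_labelK) perm_map.
exists (map opp_label L'); last by rewrite alternating_opp.
by rewrite perm_map.
Qed.

Lemma size_fan b L d : fan b L -> {in L, forall l, l.1 < d} -> size L <= d.
Proof.
move=> /fanP[L' LL' aL'] Ld; rewrite -(perm_size LL') -(size_map fst).
rewrite -[d in _ <= d](size_iota 0); apply: uniq_leq_size.
  exact: sorted_uniq ltn_trans ltnn _ (alternating_ltn aL').
move=> i /mapP[l lL' ->]; rewrite mem_iota /= Ld //.
by rewrite -(perm_mem LL').
Qed.

(** The combinatorial core: deleting one label from a sorted consistent sequence
    leaves a sequence alternating from [b] in an odd number of ways exactly when
    the sequence itself alternates.  If it does and starts with [b], only the
    last label can be deleted, and if it starts with the other sign, only the
    first one.  Otherwise two adjacent labels have equal signs; deleting either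
    of them gives the same outcome, and any other deletion keeps both. *)
Lemma coboundary_alternating b L :
    sorted label_le L -> consistent L -> L != [::] ->
  coboundary (alternating b) L = alternating b L (+) alternating (~~ b) L.
Proof.
elim: L b => [//|x [|y L] IHL] b sL cL _.
  rewrite coboundary_cons /coboundary /pairing big_nil /=.
  by case: (x.2); case: b.
rewrite coboundary_cons.
have sL' : sorted label_le (y :: L) by exact: path_sorted sL.
have cL' : consistent (y :: L).
  by move=> u v uL vL; apply: cL; rewrite inE ?uL ?vL orbT.
have xy : label_le x y by case/andP: sL.
have [xy1|xy1] := eqVneq x.1 y.1.
  have exy : x = y by apply: cL => //; rewrite !inE eqxx ?orbT.
  (* Two equal labels in front: the first two faces coincide, and every other
     face still contains both copies. *)
  have alt_xx c s : alternating c (x :: x :: s) = false.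
    by rewrite /= ltnn !andbF.
  rewrite -exy coboundary_cons addbA addbb /=.
  rewrite [RHS](_ : _ = false) ?ltnn ?andbF //.
  by apply: pairing0 => s _; exact: alt_xx.
have xy2 : x.1 < y.1.
  by move: xy; rewrite /label_le (negbTE xy1) orbF.
have -> : coboundary (alternating b \o cons x) (y :: L) =
    (x.2 == b) && coboundary (alternating (~~ b)) (y :: L).
  case: (x.2 =P b) => [xb|xb] /=; last first.
    by apply: pairing0 => s _ /=; case: eqP xb.
  apply: eq_pairing => s sL'' /=; rewrite xb eqxx /=.
  suff : (if s is l' :: _ then x.1 < l'.1 else true) = true by move=> ->.
  case: s sL'' => [//|z s] zL.
  have zyL : z \in y :: L by apply: (face_subset zL); rewrite inE eqxx.
  move: (sL') => /= /(order_path_min label_le_trans)/allP yL.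
  move: zyL; rewrite inE => /predU1P[->//|/yL].
  by rewrite /label_le => /orP[/(ltn_trans xy2)//|/andP[/eqP <-]].
rewrite (IHL _ sL' cL') //.
have altE c : alternating c (x :: y :: L) =
    [&& x.2 == c, x.1 < y.1 & alternating (~~ c) (y :: L)] by [].
rewrite !altE xy2 negbK.
move: (alternating b (y :: L)) (alternating (~~ b) (y :: L)) => A B.
by case: (x.2); case: b; case: A; case: B.
Qed.

Lemma coboundary_fan b L : consistent L -> L != [::] ->
  coboundary (fan b) L = fan b L (+) fan (~~ b) L.
Proof.
move=> cL L0; rewrite (coboundary_perm (s2 := sort label_le L)); first last.
- by rewrite perm_sym perm_sort.
- exact: fan_perm.
have sL := sort_sorted label_le_total L.
rewrite -coboundary_alternating //; first last.
- by rewrite -size_eq0 size_sort size_eq0.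
- by move=> u v; rewrite !mem_sort; exact: cL.
apply: eq_pairing => s sL'; rewrite /fan (sorted_sort label_le_trans) //.
exact: (subseq_sorted label_le_trans (faces_subseq sL')).
Qed.

End Labels.

(** Chains [t k] of dimension [k] playing the part of the upper hemispheres of
    nested spheres: the boundary of the [k.+1]-st one is the [k]-sphere, that is
    the [k]-th hemisphere together with its antipode. *)
Section Fan.
Local Open Scope nat_scope.
Variables (T : eqType) (nu : T -> T) (lab : T -> label).
Variables (d : nat) (t : nat -> seq (seq T)).
Hypothesis size_t : forall k, {in t k, forall s, size s = k.+1}.
Hypothesis t0 : pairing (fun=> true) (t 0).
Hypothesis boundary_t : forall k phi, pairing phi (boundary (t k.+1)) =
  pairing phi (t k) (+) pairing (phi \o map nu) (t k).
Hypothesis lab_nu : forall k s x, k <= d -> s \in t k -> x \in s ->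
  lab (nu x) = opp_label (lab x).
Hypothesis lab_consistent : forall k s, k <= d -> s \in t k ->
  consistent (map lab s).

Lemma faces_lab (s : seq T) : faces (map lab s) = map (map lab) (faces s).
Proof. by elim: s => [//|x s IHs] /=; rewrite IHs -!map_comp. Qed.

(** The alternating simplices of either starting sign in [t k.+1] have the same
    parity as the simplices of its boundary that alternate from [true].  Under
    the antipodal map those in the lower half become the simplices of [t k] that
    alternate from [false], so the parity is that of [t k], and finally that of
    [t 0], a single vertex up to cancellation. *)
Lemma fan_parity k : k <= d ->
  pairing (fun s => fan true (map lab s) (+) fan false (map lab s)) (t k).
Proof.
elim: k => [|k IHk] kd.
  rewrite (eq_pairing (psi := fun=> true)) // => s /size_t.
  case: s => [//|x [|//]] _ /=.
  by rewrite /fan /= ?andbT; case: (lab x).2.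
rewrite (eq_pairing (psi := coboundary (fan true \o map lab))); last first.
  move=> s st.
  rewrite -(coboundary_fan true (lab_consistent kd st)); last first.
    by have := size_t st; case: s {st}.
  by rewrite /coboundary faces_lab /pairing big_map.
rewrite -pairing_boundary boundary_t -pairingD.
apply: etrans (IHk (ltnW kd)); apply: eq_pairing => s st /=; congr (_ (+) _).
rewrite -(fan_opp true) -map_comp; congr (fan _ _).
by rewrite -map_comp; apply/eq_in_map => x xs /=; rewrite (lab_nu (ltnW kd) st).
Qed.

(** Some [d]-simplex carries [d.+1] labels with distinct absolute values. *)
Lemma fan_needs_more_labels :
  ~ (forall s x, s \in t d -> x \in s -> (lab x).1 < d).
Proof.
move=> lab_d; have := fan_parity (leqnn d); rewrite pairing0 // => s st.
have fan0 b : fan b (map lab s) = false.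
  apply/negP => /size_fan fan_d.
  have /fan_d : {in map lab s, forall l, l.1 < d}.
    by move=> _ /mapP[x xs ->]; exact: lab_d xs.
  by rewrite size_map (size_t st) ltnn.
by rewrite !fan0.
Qed.
End Fan.

(** * Fine triangulations of hemispheres *)

Section Barycenter.
Variables (R : realType) (V : normedModType R).
Implicit Types (s : seq V).

Definition barycenter s : V := (size s)%:R^-1 *: \sum_(x <- s) x.

Lemma barycenterN s : barycenter (map -%R s) = - barycenter s.
Proof. by rewrite /barycenter size_map big_map sumrN scalerN. Qed.

(** Properties inherited by barycenters pass to all vertices of a subdivision;
    applied to balls and to the faces of the cross-polytope. *)
Lemma sd_closed (C : set V) n s u :
    (forall t, t != [::] -> {in t, forall x, C x} -> C (barycenter t)) ->
    size s = n -> {in s, forall x, C x} -> u \in sd barycenter n s ->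
  {in u, forall x, C x}.
Proof.
move=> Cb sn sC us; move: n s u sn us sC.
apply: sd_ind => // n s t u sn ts _ IH sC.
move=> x; rewrite inE => /predU1P[->|].
  by apply: Cb => //; rewrite -size_eq0 sn.
by apply: IH => y yt; apply: sC; exact: face_subset ts _ yt.
Qed.

Lemma ball_barycenter (c : V) (r : R) s : s != [::] ->
  {in s, forall x, `|c - x| <= r} -> `|c - barycenter s| <= r.
Proof.
rewrite -size_eq0 -lt0n => s0 sr.
have s0' : (size s)%:R != 0 :> R by rewrite pnatr_eq0 -lt0n.
have -> : c - barycenter s = (size s)%:R^-1 *: \sum_(x <- s) (c - x).
  rewrite big_split /= sumrN scalerDr scalerN; congr (_ - _).
  rewrite big_const_seq count_predT iter_addr addr0.
  rewrite -[X in _ = _ *: X]scaler_nat.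
  by rewrite scalerA mulVf // scale1r.
rewrite normrZ ger0_norm ?invr_ge0 // ler_pdivrMl ?ltr0n //.
apply: le_trans (ler_norm_sum _ _ _) _.
rewrite mulr_natl -[size s]count_predT -iter_addr_0 -big_const_seq.
by rewrite big_seq [leRHS]big_seq; apply: ler_sum.
Qed.

(** The vertex [v] itself contributes nothing to the average of the distances;
    this is where the contraction factor comes from. *)
Lemma barycenter_dist (D : R) s v : v \in s ->
    {in s &, forall x y, `|x - y| <= D} ->
  `|barycenter s - v| <= (1 - (size s)%:R^-1) * D.
Proof.
move=> vs sD.
have s0 : (0 < size s)%N by case: s vs sD.
have s0' : (size s)%:R != 0 :> R by rewrite pnatr_eq0 -lt0n.
have -> : barycenter s - v = (size s)%:R^-1 *: \sum_(x <- s) (x - v).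
  rewrite big_split /= sumrN scalerBr; congr (_ - _).
  rewrite big_const_seq count_predT iter_addr addr0.
  rewrite -[X in _ = _ *: X]scaler_nat.
  by rewrite scalerA mulVf // scale1r.
rewrite normrZ ger0_norm ?invr_ge0 // ler_pdivrMl ?ltr0n //.
rewrite mulrA mulrBr mulr1 mulfV // (perm_big _ (perm_to_rem vs)) big_cons.
rewrite /= subrr add0r; apply: le_trans (ler_norm_sum _ _ _) _.
have -> : (size s)%:R - 1 = (size (rem v s))%:R :> R.
  by rewrite size_rem // -[in LHS](prednK s0) -addn1 natrD addrK.
rewrite mulr_natl -[size _]count_predT -iter_addr_0 -big_const_seq.
rewrite big_seq [leRHS]big_seq; apply: ler_sum => x /mem_rem xs.
exact: sD.
Qed.

(** Of two vertices of a piece, either both lie in the subdivision of a proper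
    face, or one is the barycenter of [s], and a ball around the barycenter that
    contains the vertices of [s] contains all their barycenters. *)
Lemma sd_mesh (th D : R) n s u : 0 <= D -> 1 - n%:R^-1 <= th -> 0 <= th ->
    size s = n -> u \in sd barycenter n s ->
    {in s &, forall x y, `|x - y| <= D} ->
  {in u &, forall x y, `|x - y| <= th * D}.
Proof.
move=> D0 nth th0 sn us sD; move: n s u sn us nth sD.
apply: sd_ind => // n s t u sn ts ut IH nth sD.
have uD : {in u &, forall x y, `|x - y| <= th * D}.
  case: n ut IH {sn} nth => [|n] ut IH nth.
    by move: ut; rewrite inE => /eqP->.
  apply: IH => [|x y xt yt]; last by apply: sD; apply: face_subset ts _ _.
  apply: le_trans nth; rewrite lerD2l lerN2.
  by rewrite lef_pV2 ?posrE ?ltr0n // ler_nat.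
have bD : {in u, forall x, `|barycenter s - x| <= th * D}.
  have tn : size t = n by exact: size_faces sn ts.
  apply: (sd_closed (C := [set x | `|barycenter s - x| <= th * D])) tn _ ut.
    by move=> w w0 wC; exact: ball_barycenter.
  move=> x xt /=; apply: le_trans (barycenter_dist _ sD) _.
    exact: face_subset ts _ xt.
  by rewrite sn ler_wpM2r.
have th_D : 0 <= th * D by exact: mulr_ge0.
move=> x y; rewrite !inE => /predU1P[->|xu] /predU1P[->|yu].
- by rewrite subrr normr0.
- exact: bD.
- by rewrite distrC bD.
- exact: uD.
Qed.

End Barycenter.

Section Hemispheres.
Variables (R : realType) (d : nat).
Local Notation V := 'rV[R]_d.+1.

Definition axis (k : nat) : V := \row_j (j == k :> nat)%:R.

(** The upper half of the boundary of the cross-polytope with vertices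
    [axis 0, ..., axis k] and their antipodes. *)
Fixpoint hemisphere k : seq (seq V) :=
  if k is k'.+1 then
    map (cons (axis k)) (hemisphere k' ++ map (map -%R) (hemisphere k'))
  else [:: [:: axis 0]].

Lemma map_oppK : involutive (map (-%R : V -> V)).
Proof. by apply: mapK; exact: opprK. Qed.

Lemma boundary_opp (phi : seq V -> bool) c :
  pairing phi (boundary (map (map -%R) c)) =
  pairing (phi \o map -%R) (boundary c).
Proof.
rewrite !pairing_boundary pairing_map; apply: eq_pairing => s _ /=.
by rewrite /coboundary faces_map pairing_map.
Qed.

(** The base of the cone is a cycle, since its boundary is a chain plus its
    antipode, counted twice. *)
Lemma boundary_hemisphere k phi : pairing phi (boundary (hemisphere k.+1)) =
  pairing phi (hemisphere k) (+) pairing (phi \o map -%R) (hemisphere k).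
Proof.
suff cycle psi : pairing psi
    (boundary (hemisphere k ++ map (map -%R) (hemisphere k))) = false.
  by rewrite pairing_boundary_cone cycle addbF pairing_cat pairing_map.
elim: k psi {phi} => [|k IHk] psi.
  by rewrite /boundary /pairing /= !big_cons big_nil addbF addbb.
rewrite /boundary map_cat flatten_cat -/(boundary _) pairing_cat.
rewrite -/(boundary (map _ _)) boundary_opp.
rewrite ![hemisphere k.+1]/= !pairing_boundary_cone !IHk !addbF.
rewrite !pairing_cat !pairing_map.
rewrite [X in _ (+) (_ (+) X)](_ : _ = pairing psi (hemisphere k)).
  by rewrite [X in _ (+) X]addbC addbb.
by apply: eq_pairing => s _; rewrite /comp map_oppK.
Qed.

Lemma size_hemisphere k : {in hemisphere k, forall s, size s = k.+1}.
Proof.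
elim: k => [|k IHk] s; first by rewrite inE => /eqP->.
move=> /mapP[u + ->] /=; rewrite mem_cat => /orP[/IHk->//|].
by move=> /mapP[v /IHk vk ->]; rewrite size_map vk.
Qed.

(** When [sg] is a vector of signs this contains the facet of the cross-polytope
    on which [sg] is the supporting functional. *)
Definition octant (sg : V) : set V :=
  [set x | (\sum_i sg 0 i * x 0 i = 1) /\ forall i, `|x 0 i| <= 1].

(** A compact symmetric set that contains the boundary of the cross-polytope but
    not the origin.  Bounding the sum of absolute values from below only,
    instead of fixing it, makes membership immediate for points of
    [octant sg]. *)
Definition cube_shell : set V :=
  [set x | (forall i, `|x 0 i| <= 1) /\ 1 <= \sum_i `|x 0 i|].

Lemma octant_shell (sg : V) : (forall i, `|sg 0 i| <= 1) ->
  octant sg `<=` cube_shell.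
Proof.
move=> sg1 x [sx x1]; split => //; rewrite -sx; apply: ler_sum => i _.
apply: le_trans (ler_norm _) _; rewrite normrM.
by rewrite ler_piMl.
Qed.

Lemma barycenterE (s : seq V) i :
  (barycenter s : V) 0 i = (size s)%:R^-1 * \sum_(x <- s) x 0 i.
Proof. by rewrite mxE summxE. Qed.

Lemma octant_barycenter sg (s : seq V) : s != [::] ->
  {in s, forall x, octant sg x} -> octant sg (barycenter s).
Proof.
move=> s0 sC; have s0' : (size s)%:R != 0 :> R by rewrite pnatr_eq0 size_eq0.
split=> [|i].
  under eq_bigr do rewrite barycenterE mulrCA mulr_sumr.
  rewrite -mulr_sumr exchange_big /=.
  rewrite (eq_big_seq (fun=> 1)) => [|x /sC[]//].
  by rewrite big_const_seq count_predT iter_addr_0 mulVf.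
have -> : (barycenter s : V) 0 i = @barycenter R R^o [seq (x : V) 0 i | x <- s].
  by rewrite barycenterE /barycenter size_map big_map.
rewrite -normrN -[- _]sub0r; apply: (@ball_barycenter R R^o).
  by rewrite -size_eq0 size_map size_eq0.
by move=> _ /mapP[x /sC[_ x1] ->]; rewrite sub0r normrN.
Qed.

(** The clause on vanishing coordinates lets the induction choose the sign of
    the new coordinate freely. *)
Lemma hemisphere_octant k s : (k <= d)%N -> s \in hemisphere k ->
  (exists2 sg : V, forall i, `|sg 0 i| <= 1 & {in s, forall x, octant sg x}) /\
  {in s, forall (x : V) (j : 'I_d.+1), (k < j)%N -> x 0 j = 0}.
Proof.
have axis1 j i : `|axis j 0 i| <= 1.
  by rewrite mxE; case: (_ == _); rewrite ?normr1 ?normr0.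
elim: k s => [|k IHk] s kd.
  rewrite inE => /eqP ->; split; last first.
    by move=> x; rewrite inE => /eqP -> j j0; rewrite mxE gtn_eqF.
  exists (axis 0) => // x; rewrite inE => /eqP ->; split => //.
  rewrite (bigD1 ord0) //= !mxE eqxx mulr1 big1 ?addr0 // => i i0.
  by rewrite !mxE -val_eqE /= in i0 *; rewrite (negbTE i0) mulr0.
have cone (u : seq V) :
    (exists2 sg : V, forall i, `|sg 0 i| <= 1 &
       {in u, forall x, octant sg x}) ->
    {in u, forall (x : V) (j : 'I_d.+1), (k < j)%N -> x 0 j = 0} ->
  (exists2 sg : V, forall i, `|sg 0 i| <= 1 &
     {in axis k.+1 :: u, forall x, octant sg x}) /\
  {in axis k.+1 :: u, forall (x : V) (j : 'I_d.+1), (k.+1 < j)%N -> x 0 j = 0}.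
  move=> [sg sg1 usg] uk; split; last first.
    move=> x; rewrite inE => /predU1P[->|/uk xk] j kj.
      by rewrite mxE gtn_eqF.
    by apply: xk; exact: ltnW.
  (* The supporting functional of the base, extended by 1 on the new axis. *)
  exists (\row_j if (j <= k)%N then sg 0 j else (j == k.+1 :> nat)%:R).
    move=> i; rewrite mxE; case: ifP => // _.
    by case: (_ == _); rewrite ?normr1 ?normr0.
  move=> x; rewrite inE => /predU1P[->|xu]; split => //.
  - pose i0 : 'I_d.+1 := Ordinal (kd : (k.+1 < d.+1)%N).
    rewrite (bigD1 i0) //= !mxE /= ltnn eqxx mulr1 big1 ?addr0 // => i ii0.
    rewrite !mxE -val_eqE /= in ii0 *.
    by rewrite (negbTE ii0) mulr0.
  - have [<- _] := usg x xu; apply: eq_bigr => i _; rewrite mxE.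
    by case: leqP => // ki; rewrite (uk x) // !mulr0.
  - by have [] := usg x xu.
move=> /mapP[u + ->]; rewrite mem_cat => /orP[us|/mapP[v vs ->]].
  by have [||? ?] := IHk u; [exact: ltnW|by []|exact: cone].
have [||[sg sg1 vsg] vk] := IHk v; [exact: ltnW|by []|].
apply: cone.
  exists (- sg) => [i|_ /mapP[x xv ->]]; first by rewrite mxE normrN.
  have [sx x1] := vsg x xv; split => [|i]; last by rewrite mxE normrN.
  by rewrite -sx; apply: eq_bigr => i _; rewrite !mxE mulrNN.
by move=> _ /mapP[x xv ->] j kj; rewrite mxE (vk x) // oppr0.
Qed.

Definition fine_hemisphere N k :=
  iter N (subdivision (@barycenter R V) k.+1) (hemisphere k).

Lemma size_fine N k : {in fine_hemisphere N k, forall s, size s = k.+1}.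
Proof.
elim: N => [|N IHN]; first exact: size_hemisphere.
exact: size_subdivision.
Qed.

Lemma boundary_fine N k phi :
  pairing phi (boundary (fine_hemisphere N k.+1)) =
  pairing phi (fine_hemisphere N k) (+)
  pairing (phi \o map -%R) (fine_hemisphere N k).
Proof.
elim: N phi => [|N IHN] phi; first exact: boundary_hemisphere.
rewrite /fine_hemisphere !iterS -!/(fine_hemisphere _ _).
rewrite boundary_subdivision; last exact: size_fine.
rewrite !pairing_subdivision IHN; congr (_ (+) _); apply: eq_pairing => s _.
rewrite -[LHS]/(pairing phi (sd _ k.+1 (map -%R s))).
by rewrite (sd_map (@barycenterN R V)) pairing_map.
Qed.

Lemma odd_fine N : pairing (fun=> true) (fine_hemisphere N 0).
Proof.
elim: N => [|N IHN]; first by rewrite /pairing big_seq1.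
rewrite /fine_hemisphere !iterS -!/(fine_hemisphere _ _) pairing_subdivision.
apply: etrans IHN; apply: eq_pairing => s /size_fine.
by case: s => [//|x [|//]] _; rewrite /= /pairing big_seq1.
Qed.

Lemma fine_octant N k s : (k <= d)%N -> s \in fine_hemisphere N k ->
  exists2 sg : V, forall i, `|sg 0 i| <= 1 & {in s, forall x, octant sg x}.
Proof.
move=> kd; elim: N s => [|N IHN] s; first by case/(hemisphere_octant kd).
rewrite /fine_hemisphere iterS -/(fine_hemisphere _ _).
move=> /flattenP[w /mapP[t tN ->] st]; have [sg sg1 tsg] := IHN t tN.
exists sg => // x xs.
apply: (sd_closed _ _ tsg st) => //; first exact: octant_barycenter.
exact: size_fine tN.
Qed.

Lemma fine_shell N k s x : (k <= d)%N -> s \in fine_hemisphere N k ->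
  x \in s -> cube_shell x.
Proof.
by move=> kd /(fine_octant kd)[sg sg1 sC] /sC; exact: octant_shell.
Qed.

Lemma mx_norm_le (m : nat) (x : 'rV[R]_m) (r : R) : 0 <= r ->
  (forall i, `|x 0 i| <= r) -> `|x| <= r.
Proof.
move=> r0 xr; rewrite /Num.norm /= mx_normrE.
apply/bigmax_leP; split=> // -[i j] _ /=.
by rewrite ord1.
Qed.

Lemma coord_le_norm (m : nat) (x : 'rV[R]_m) i : `|x 0 i| <= `|x|.
Proof.
rewrite [leRHS]/Num.norm /= mx_normrE; apply: (le_bigmax _ _ (0, i)).
Qed.

(** The factor by which barycentric subdivision shrinks simplices with at most
    [d.+1] vertices. *)
Definition mesh_ratio : R := 1 - d.+1%:R^-1.

Lemma fine_mesh N k s : (k <= d)%N -> s \in fine_hemisphere N k ->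
  {in s &, forall x y, `|x - y| <= mesh_ratio ^+ N * 2}.
Proof.
have th0 : 0 <= mesh_ratio.
  by rewrite subr_ge0 invf_le1 ?ltr0n // ler1n.
move=> kd; elim: N s => [|N IHN] s.
  move=> /(fine_octant (N := 0) kd)[sg _ sC] x y /sC[_ x1] /sC[_ y1].
  rewrite expr0 mul1r; apply: mx_norm_le => // i; rewrite !mxE.
  by apply: le_trans (ler_normB _ _) _; rewrite -[2]/(1 + 1) lerD.
rewrite /fine_hemisphere iterS -/(fine_hemisphere _ _).
move=> /flattenP[w /mapP[t tN ->] st]; rewrite exprS -mulrA.
apply: (sd_mesh _ _ _ _ st (IHN t tN)) => //.
- by rewrite mulr_ge0 // exprn_ge0.
- by rewrite lerD2l lerN2 lef_pV2 ?posrE ?ltr0n // ler_nat.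
- exact: size_fine tN.
Qed.

End Hemispheres.

(** * The Borsuk-Ulam theorem *)

Section Continuity.
Variables (R : realType).

Lemma continuous_fsum (T : topologicalType) (m : nat) (F : 'I_m -> T -> R) :
  (forall i, continuous (F i)) -> continuous (fun x => \sum_(i < m) F i x).
Proof.
move=> cF; apply: continuous_big => [|i _]; last exact: cF.
exact: add_continuous.
Qed.

Lemma continuous_rV (T : topologicalType) (m : nat) (f : T -> 'rV[R]_m) x :
  (forall i, {for x, continuous (fun y => f y 0 i)}) -> {for x, continuous f}.
Proof.
move=> cf; apply/cvgrPdist_le => e e0.
have : \forall y \near x, forall i, `|f x 0 i - f y 0 i| <= e.
  apply: filter_forall => i; exact: (cvgrPdist_le _ _).1 (cf i) e e0.
apply: filterS => y fe; apply: mx_norm_le; first exact: ltW.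
by move=> i; rewrite !mxE.
Qed.

Lemma closed_sublevel (T : topologicalType) (f : T -> R) a :
  continuous f -> closed [set x | f x <= a].
Proof.
by move=> cf; apply: (preimage_closed _ (@closed_le R a)) => x _; exact: cf.
Qed.

Lemma closed_superlevel (T : topologicalType) (f : T -> R) a :
  continuous f -> closed [set x | a <= f x].
Proof.
by move=> cf; apply: (preimage_closed _ (@closed_ge R a)) => x _; exact: cf.
Qed.

Lemma continuous_coord_norm (m : nat) (i : 'I_m) :
  continuous (fun x : 'rV[R]_m => `|x 0 i|).
Proof.
move=> x; apply: (continuous_comp (f := fun y : 'rV[R]_m => y 0 i)).
  exact: coord_continuous.
exact: norm_continuous.
Qed.

Lemma compact_cube_shell d : compact (@cube_shell R d).
Proof.
apply: bounded_closed_compact.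
  exists 1; split => // r r1 x [x1 _] /=.
  by apply: le_trans (ltW r1); apply: mx_norm_le.
have -> : @cube_shell R d =
    (\bigcap_(i in [set: 'I_d.+1]) [set x : 'rV[R]_d.+1 | `|x 0 i| <= 1]) `&`
    [set x | 1 <= \sum_i `|x 0 i|].
  by apply/seteqP; split => x [x1 x2]; split => // i; [move=> _|]; apply: x1.
apply: closedI; last first.
  apply: closed_superlevel; apply: continuous_fsum.
  exact: continuous_coord_norm.
apply: closed_bigI => i _; apply: closed_sublevel.
exact: continuous_coord_norm.
Qed.

(** Heine's theorem for a function that is continuous on a compact set only. *)
Lemma uniform_continuity (U V : normedModType R) (K : set U) (f : U -> V) e :
    compact K -> {within K, continuous f} -> 0 < e ->
  exists2 r, 0 < r & forall x y, K x -> K y -> `|x - y| < r -> `|f x - f y| < e.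
Proof.
move=> cK /subspace_continuousP cf e0.
have e20 : 0 < e / 2 by rewrite divr_gt0.
have /compact_near_coveringP ncK := cK.
have := ncK R (0^'+) (fun r x => forall y, K x -> K y -> `|x - y| < r ->
  `|f x - f y| < e) _.
have H : forall x, K x -> \forall x' \near x & r \near 0^'+,
    forall y, K x' -> K y -> `|x' - y| < r -> `|f x' - f y| < e.
  move=> x Kx; have cfx : f @ within K (nbhs x) --> f x := cf x Kx.
  have : \forall y \near x, K y -> `|f x - f y| < e / 2.
    by move: cfx => /cvgrPdist_lt; exact.
  move=> /nbhs_normP[r r0 fr].
  have r20 : 0 < r / 2 by rewrite divr_gt0.
  exists ([set x' | `|x - x'| < r / 2], [set s | s < r / 2]).
    split=> /=; last exact: nbhs_right_lt.
    by apply/nbhs_normP; exists (r / 2).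
  move=> [x' s] /= [xx' sr] y Kx' Ky x'y.
  have fx' : `|f x - f x'| < e / 2.
    apply: fr => //=; apply: lt_trans xx' _.
    by rewrite ltr_pdivrMr // ltr_pMr // ltr1n.
  have fy : `|f x - f y| < e / 2.
    apply: fr => //=; rewrite [r]splitr -[x - y](subrKA x').
    by apply: le_lt_trans (ler_normD _ _) _; rewrite ltrD // (lt_trans x'y).
  rewrite -[f x' - f y](subrKA (f x)) [e]splitr.
  by apply: le_lt_trans (ler_normD _ _) _; rewrite ltrD // distrC.
move=> /(_ _ H) nearK.
have [r [r0 rK]] := filter_ex (filterI (nbhs_right_gt (0 : R)) nearK).
by exists r => // x y Kx Ky; apply: rK.
Qed.

(** If [f] had no zero, its norm would be at least some [e > 0].  Label a point
    by the first coordinate of [f] of absolute value at least [e], with its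
    sign.  The labels are odd because [f] is, and on a simplex on which [f]
    varies by less than [e] no two of them are opposite.  On a sufficiently fine
    triangulation this contradicts Ky Fan's lemma, as only [t <= d] absolute
    values are available. *)
Theorem borsuk_ulam d t (f : 'rV[R]_d.+1 -> 'rV[R]_t) : (t <= d)%N ->
    {within @cube_shell R d, continuous f} ->
    (forall x, cube_shell x -> f (- x) = - f x) ->
  exists2 x, cube_shell x & f x = 0.
Proof.
move=> td cf fodd; apply: contrapT => f0.
have f_neq0 x : cube_shell x -> f x != 0.
  by move=> Kx; apply/eqP => fx0; apply: f0; exists x.
have cK := @compact_cube_shell d.
have K0 : cube_shell (axis R d 0).
  apply: (@fine_shell _ _ 0 0 [:: axis R d 0]) => //; exact: mem_head.
have [m Km fm] : exists2 m, m \in @cube_shell R d &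
    forall x, x \in @cube_shell R d -> `|f m| <= `|f x|.
  apply: (compact_EVT_min (f := fun x => `|f x|)) cK _.
    by exists (axis R d 0).
  move=> x; apply: (continuous_comp (f := (f : subspace _ -> _))).
    exact: cf.
  exact: norm_continuous.
set e := `|f m| in fm.
have e0 : 0 < e by rewrite normr_gt0 f_neq0 // -inE.
have [r r0 fr] := uniform_continuity cK cf e0.
have [N hN] : exists N, mesh_ratio R d ^+ N * 2 < r.
  have th1 : `|mesh_ratio R d| < 1.
    rewrite ger0_norm /mesh_ratio; last first.
      by rewrite subr_ge0 invf_le1 ?ltr0n // ler1n.
    by rewrite ltrBlDr ltrDl invr_gt0 ltr0n.
  have r20 : 0 < r / 2 by rewrite divr_gt0.
  have /cvgrPdist_lt/(_ _ r20)/filter_ex[N] := cvg_expr th1.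
  rewrite sub0r normrN => hN.
  by exists N; rewrite -ltr_pdivlMr // (le_lt_trans (ler_norm _) hN).
pose lab (x : 'rV[R]_d.+1) : label :=
  if [pick i | e <= `|f x 0 i|] is Some i then (i : nat, 0 < f x 0 i)
  else (0%N, true).
have labP x : cube_shell x -> exists i : 'I_t,
    [/\ lab x = (i : nat, 0 < f x 0 i), e <= `|f x 0 i| &
      [pick i | e <= `|f x 0 i|] = Some i].
  move=> Kx; rewrite /lab; case: pickP => [i fi|fi]; first by exists i.
  have : e <= `|f x| by apply: fm; rewrite inE.
  have [|[i0 i] fxE] := @mx_norm_neq0 R 1 t (f x).
    by rewrite -[mx_norm _]/`|f x| normr_eq0 f_neq0.
  by rewrite [leRHS]fxE ord1 fi.
have labN x : cube_shell x -> lab (- x) = opp_label (lab x).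
  move=> Kx; have [i [-> fi pi]] := labP x Kx.
  have -> : lab (- x) = (i : nat, 0 < f (- x) 0 i).
    rewrite /lab; have -> : [pick i | e <= `|f (- x) 0 i|] = Some i.
      by rewrite -pi; apply: eq_pick => j; rewrite fodd // mxE normrN.
    by [].
  rewrite fodd // mxE oppr_gt0 /opp_label /= -leNgt le_eqVlt; congr pair.
  case: eqP => // fi0; move: fi; rewrite fi0 normr0.
  by rewrite leNgt e0.
apply: (@fan_needs_more_labels _ -%R lab d (fine_hemisphere R d N)).
- exact: size_fine.
- exact: odd_fine.
- exact: boundary_fine.
- by move=> k s x kd st xs; apply: labN; exact: fine_shell kd st xs.
- move=> k s kd st _ _ /mapP[x xs ->] /mapP[y ys ->].
  have [Kx Ky] := (fine_shell kd st xs, fine_shell kd st ys).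
  have [i [-> fi _]] := labP x Kx; have [j [-> fj _]] := labP y Ky.
  move=> /= /val_inj ij; subst j; congr pair.
  have xy : `|f x - f y| < e.
    by apply: fr => //; apply: le_lt_trans hN; exact: fine_mesh kd st _ _ xs ys.
  have := le_lt_trans (coord_le_norm (f x - f y) i) xy; rewrite !mxE.
  move: fi fj; move: (f x 0 i) (f y 0 i) => a b.
  rewrite ltr_norml => + + /andP[].
  case: (ltrP 0 a) => a0; case: (ltrP 0 b) => b0 //.
    rewrite (gtr0_norm a0) (ler0_norm b0); lra.
  rewrite (gtr0_norm b0) (ler0_norm a0); lra.
- move=> s x sd xs; have [i [-> _ _]] := labP x (fine_shell (leqnn d) sd xs).
  exact: leq_trans (ltn_ord i) td.
Qed.
End Continuity.

(** * Subgradients of convex functions *)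

Section Dot.
Variables (R : realType) (n : nat).
Implicit Types x y z : 'rV[R]_n.

Lemma dotvC x y : dotv x y = dotv y x.
Proof. by apply: eq_bigr => i _; rewrite mulrC. Qed.

Lemma dotvDl x y z : dotv (x + y) z = dotv x z + dotv y z.
Proof. by rewrite -big_split; apply: eq_bigr => i _; rewrite mxE mulrDl. Qed.

Lemma dotvZl a x y : dotv (a *: x) y = a * dotv x y.
Proof. by rewrite mulr_sumr; apply: eq_bigr => i _; rewrite mxE mulrA. Qed.

Lemma dotvDr x y z : dotv x (y + z) = dotv x y + dotv x z.
Proof. by rewrite ![dotv x _]dotvC dotvDl. Qed.

Lemma dotvZr a x y : dotv x (a *: y) = a * dotv x y.
Proof. by rewrite ![dotv x _]dotvC dotvZl. Qed.

Lemma dotvNr x y : dotv x (- y) = - dotv x y.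
Proof. by rewrite -scaleN1r dotvZr mulN1r. Qed.

Lemma dotvNl x y : dotv (- x) y = - dotv x y.
Proof. by rewrite dotvC dotvNr dotvC. Qed.

Lemma dotv0r x : dotv x 0 = 0.
Proof. by rewrite -(scale0r 0) dotvZr mul0r. Qed.

Lemma dotv0l x : dotv 0 x = 0.
Proof. by rewrite dotvC dotv0r. Qed.

Lemma dotv_sumr I (r : seq I) (F : I -> 'rV[R]_n) x :
  dotv x (\sum_(i <- r) F i) = \sum_(i <- r) dotv x (F i).
Proof.
elim: r => [|i r IHr]; first by rewrite !big_nil dotv0r.
by rewrite !big_cons dotvDr IHr.
Qed.

Lemma dotv_ge0 x : 0 <= dotv x x.
Proof. by apply: sumr_ge0 => i _; rewrite -expr2 sqr_ge0. Qed.

Lemma dotv_eq0 x : (dotv x x == 0) = (x == 0).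
Proof.
apply/idP/eqP => [|->]; last by rewrite dotv0r.
rewrite psumr_eq0 => [/allP x0|i _]; last by rewrite -expr2 sqr_ge0.
apply/rowP => i; rewrite mxE; apply/eqP.
by have := x0 i (mem_index_enum i); rewrite /= mulf_eq0 orbb.
Qed.

Lemma dotv_gt0 x : x != 0 -> 0 < dotv x x.
Proof. by move=> x0; rewrite lt_neqAle eq_sym dotv_eq0 x0 dotv_ge0. Qed.

Lemma dotv_delta x i : dotv x (delta_mx 0 i) = x 0 i.
Proof.
rewrite /dotv (bigD1 i) //= mxE !eqxx mulr1 big1 ?addr0 // => j ji.
by rewrite mxE eqxx (negbTE ji) mulr0.
Qed.

End Dot.

Section Subgradient.
Variables (R : realType) (n : nat) (h : 'rV[R]_n -> R).
Hypothesis h_convex : forall (x y : 'rV[R]_n) (a b : R), 0 <= a -> 0 <= b ->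
  a + b = 1 -> h (a *: x + b *: y) <= a * h x + b * h y.

Definition subgradient x xi := forall v, h x + dotv xi v <= h (x + v).

(** The choice of a slope along a new direction [e], as in the proof of the
    Hahn-Banach theorem: a convex combination of [u - t *: e] and [w + s *: e]
    cancels [e], so every slope coming from the negative side is at most every
    slope coming from the positive side. *)
Lemma subgradient_slopes x xi e u w s t :
    0 < s -> 0 < t ->
    (forall a b,
       h x + dotv xi (a *: u + b *: w) <= h (x + (a *: u + b *: w))) ->
  (h x + dotv xi u - h (x + (u - t *: e))) / t <=
  (h (x + (w + s *: e)) - h x - dotv xi w) / s.
Proof.
move=> s0 t0 uw.
have st0 : 0 < s + t by rewrite addr_gt0.
have st_neq0 : s + t != 0 by rewrite gt_eqF.
pose a := s / (s + t); pose b := t / (s + t).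
have ab1 : a + b = 1 by rewrite -mulrDl mulfV.
have := h_convex (x + (u - t *: e)) (x + (w + s *: e))
  (divr_ge0 (ltW s0) (ltW st0)) (divr_ge0 (ltW t0) (ltW st0)) ab1.
rewrite -/a -/b.
have -> : a *: (x + (u - t *: e)) + b *: (x + (w + s *: e)) =
    x + (a *: u + b *: w).
  by apply/rowP => i; rewrite !mxE /a /b; field.
move=> /(le_trans (uw a b)) le_ab.
rewrite ler_pdivrMr // mulrAC ler_pdivlMr //; move: le_ab.
rewrite dotvDr !dotvZr.
move: (h x) (h (x + (u - t *: e))) (h (x + (w + s *: e))) => h0 h1 h2.
move: (dotv xi u) (dotv xi w) => du dw.
rewrite -(ler_pM2l st0).
have -> : (s + t) * (h0 + (a * du + b * dw)) = (s + t) * h0 + s * du + t * dw.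
  by rewrite /a /b; field.
have -> : (s + t) * (a * h1 + b * h2) = s * h1 + t * h2.
  by rewrite /a /b; field.
by move=> H; lra.
Qed.

(** The subgradient is built one coordinate at a time; each new coordinate is
    the supremum of the slopes from the negative side. *)
Lemma subgradient_partial x k : (k <= n)%N ->
  exists xi, forall v : 'rV[R]_n, (forall i : 'I_n, (k <= i)%N -> v 0 i = 0) ->
    h x + dotv xi v <= h (x + v).
Proof.
elim: k => [|k IHk] kn.
  exists 0 => v v0; have -> : v = 0 by apply/rowP => i; rewrite v0 // mxE.
  by rewrite dotv0r !addr0.
have [xi xiP] := IHk (ltnW kn).
pose i0 : 'I_n := Ordinal kn.
pose e : 'rV[R]_n := delta_mx 0 i0.
pose below (u : 'rV[R]_n) := forall i : 'I_n, (k <= i)%N -> u 0 i = 0.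
have slopes u w s t : below u -> below w -> 0 < s -> 0 < t ->
    (h x + dotv xi u - h (x + (u - t *: e))) / t <=
    (h (x + (w + s *: e)) - h x - dotv xi w) / s.
  move=> ku kw s0 t0; apply: subgradient_slopes => // a b.
  by apply: xiP => i ki; rewrite !mxE ku // kw // !mulr0 addr0.
have below0 : below 0 by move=> i _; rewrite mxE.
pose A := [set r | exists u t, [/\ below u, 0 < t &
  r = (h x + dotv xi u - h (x + (u - t *: e))) / t]].
have A0 : A !=set0 by eexists; exists 0, 1; split.
have Aub w s : below w -> 0 < s ->
    ubound A ((h (x + (w + s *: e)) - h x - dotv xi w) / s).
  by move=> kw s0 _ [u [t [ku t0 ->]]]; exact: slopes.
have supA : has_sup A by split=> //; eexists; exact: (Aub 0 1).
exists (xi + (sup A - xi 0 i0) *: e) => v kv.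
pose u := v - v 0 i0 *: e.
have ku : below u.
  move=> i; rewrite leq_eqVlt => /predU1P[ki|ki]; rewrite !mxE.
    have -> : i = i0 by apply: val_inj.
    by rewrite !eqxx mulr1 subrr.
  have /negbTE-> : i != i0 by rewrite -val_eqE /= gtn_eqF.
  by rewrite (kv i ki) andbF mulr0 subrr.
have vE : v = u + v 0 i0 *: e by rewrite subrK.
have -> : dotv (xi + (sup A - xi 0 i0) *: e) v = dotv xi u + sup A * v 0 i0.
  rewrite [in RHS]/u -scaleNr dotvDr dotvZr dotvDl dotvZl dotv_delta.
  by rewrite [dotv e v]dotvC dotv_delta; ring.
have [v0|v0|v0] := ltrgtP (v 0 i0) 0.
- have t0 : 0 < - v 0 i0 by rewrite oppr_gt0.
  have : (h x + dotv xi u - h (x + (u - (- v 0 i0) *: e))) / (- v 0 i0) <=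
      sup A.
    by apply: sup_upper_bound => //; exists u, (- v 0 i0).
  rewrite scaleNr opprK -vE ler_pdivrMr //.
  by move: (h (x + v)) => *; lra.
- have : sup A <= (h (x + (u + v 0 i0 *: e)) - h x - dotv xi u) / v 0 i0.
    by apply: ge_sup => //; exact: Aub.
  rewrite -vE ler_pdivlMr //.
  by move: (h (x + v)) => *; lra.
- rewrite v0 mulr0 addr0.
  have -> : v = u by rewrite vE v0 scale0r addr0.
  exact: xiP.
Qed.

Lemma subgradient_exists x : exists xi, subgradient x xi.
Proof.
have [xi xiP] := subgradient_partial x (leqnn n).
by exists xi => v; apply: xiP => i; rewrite leqNgt ltn_ord.
Qed.

End Subgradient.

(** * The Clarke subdifferential *)

Section Clarke.
Variables (R : realType) (n : nat).
Implicit Types (F G : 'rV[R]_n -> R) (x v xi : 'rV[R]_n).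

(** Only the base point [x] itself is used to bound the limsup from below. *)
Lemma clarke_ge F x v c :
    (forall t, 0 < t -> c <= (F (x + t *: v) - F x) / t) ->
  (c%:E <= clarke_derivative F x v)%E.
Proof.
move=> cF; apply: le_ereal_inf_tmp => _ [V [[P Q] [/= xP Q0] PQ] <-].
have [t [t0 Qt]] := filter_ex (filterI (nbhs_right_gt (0 : R)) Q0).
apply: le_ereal_sup_tmp; exists ((F (x + t *: v) - F x) / t)%:E.
  exists (x, t) => //; apply: PQ; split => //=; exact: nbhs_singleton.
by rewrite lee_fin cF.
Qed.

Lemma clarke_le F x v c :
    (\forall z \near filter_prod (nbhs x) (0 : R)^'+,
      (F (z.1 + z.2 *: v) - F z.1) / z.2 <= c) ->
  (clarke_derivative F x v <= c%:E)%E.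
Proof.
move=> Fc; apply: ge_ereal_inf; eexists; first by exists
  [set z : 'rV[R]_n * R | (F (z.1 + z.2 *: v) - F z.1) / z.2 <= c].
by apply: ge_ereal_sup => _ [z /= zc <-]; rewrite lee_fin.
Qed.

Lemma clarke_cvg_le F (b : 'rV[R]_n * R -> R) x v c :
    (\forall z \near filter_prod (nbhs x) (0 : R)^'+,
      (F (z.1 + z.2 *: v) - F z.1) / z.2 <= b z) ->
    b @ filter_prod (nbhs x) (0 : R)^'+ --> c ->
  (clarke_derivative F x v <= c%:E)%E.
Proof.
move=> Fb bc; apply/lee_addgt0Pr => e e0; rewrite -EFinD; apply: clarke_le.
have : \forall z \near filter_prod (nbhs x) (0 : R)^'+, `|c - b z| < e.
  by move: bc => /cvgrPdist_lt; apply.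
move=> be; near=> z.
apply: le_trans (near Fb z _) _ => //.
rewrite -lerBlDl; apply: le_trans (ltW (near be z _)) => //.
by rewrite distrC ler_norm.
Unshelve. all: by end_near. Qed.

(** The slope of a global affine minorant touching [F] at [x] is a Clarke
    subgradient even when [F] is not convex.  This replaces a sum rule for
    Clarke subdifferentials when [F - lambda G] is minimised. *)
Lemma subgradient_subdiff F x xi : subgradient F x xi -> subdiff F x xi.
Proof.
move=> xiF v; apply: clarke_ge => t t0.
by rewrite ler_pdivlMr // lerBrDl mulrC -dotvZr; exact: xiF.
Qed.

Lemma at_right0_cvg0 : (t @[t --> (0 : R)^'+]) --> (0 : R).
Proof. exact: cvg_within. Qed.

(** By convexity the difference quotients with step [t < 1] are at most the
    difference with step 1, which is continuous in the base point. *)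
Lemma convex_subdiff_subgradient G x xi : continuous G ->
    (forall (x y : 'rV[R]_n) (a b : R), 0 <= a -> 0 <= b -> a + b = 1 ->
      G (a *: x + b *: y) <= a * G x + b * G y) ->
  subdiff G x xi -> subgradient G x xi.
Proof.
move=> cG Gc xiG v; rewrite addrC -lerBrDr -lee_fin.
apply: le_trans (xiG v) _.
apply: (clarke_cvg_le (b := fun z => G (z.1 + v) - G z.1)).
  exists (setT, [set t | 0 < t /\ t < 1]).
    split=> /=; first exact: filterT.
    by apply: filterI; [exact: nbhs_right_gt|exact: nbhs_right_lt].
  move=> [y t] /= [_ [t0 t1]]; rewrite ler_pdivrMr //.
  have -> : y + t *: v = (1 - t) *: y + t *: (y + v).
    by apply/rowP => i; rewrite !mxE; ring.
  have := Gc y (y + v) (1 - t) t _ (ltW t0) (subrK _ _).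
  rewrite subr_ge0 (ltW t1) => /(_ isT) H; lra.
have cv : continuous (fun y : 'rV[R]_n => G (y + v) - G y).
  move=> y; apply: continuousB; last exact: cG.
  apply: (continuous_comp (f := fun y : 'rV[R]_n => y + v)); last exact: cG.
  by apply: continuousD => //; exact: cst_continuous.
apply: (cvg_comp _ (fun y : 'rV[R]_n => G (y + v) - G y) cvg_fst); exact: cv.
Qed.

Lemma locally_lipschitzP F x : locally_lipschitz F ->
  exists U L, [/\ nbhs x U, 0 <= L &
    forall y z, U y -> U z -> `|F y - F z| <= L * `|y - z|].
Proof.
move=> /(_ x)[U xU FU].
have [L [L0 UL]] := filter_ex (filterI (nbhs_pinfty_ge (num_real 0)) FU).
exists U, L; split=> // y z Uy Uz; exact: (UL (y, z)).
Qed.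

Lemma locally_lipschitz_continuous F : locally_lipschitz F -> continuous F.
Proof.
move=> Fl x; have [U [L [xU L0 UL]]] := locally_lipschitzP x Fl.
apply/(@cvgrPdist_le _ R^o _ (nbhs x)) => e e0.
have L1 : 0 < L + 1 by rewrite ltr_pwDr.
have eL : 0 < e / (L + 1) by rewrite divr_gt0.
have : \forall y \near x, `|x - y| < e / (L + 1) /\ U y.
  apply: filterI => //.
  apply: (nbhs_normP x (fun y => `|x - y| < e / (L + 1))).2.
  by exists (e / (L + 1)).
apply: filterS => y [xy Uy]; apply: le_trans (UL x y (nbhs_singleton xU) Uy) _.
apply: le_trans (_ : (L + 1) * `|x - y| <= _).
  by rewrite ler_wpM2r // lerDl.
by rewrite mulrC -ler_pdivlMr // ltW.
Qed.

Lemma powR_slope_cvg (p s : R) :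
  (((1 + s * t) `^ p - 1) / t) @[t --> (0 : R)^'+] --> s * p.
Proof.
have [dp pE] := is_derive1_powR p (@ltr01 R).
have /derivable1_diffP dif := dp.
have ps := diff_derivable (v := s) dif.
have Es : 'D_s ((@powR R)^~ p) (1 : R) = s * p.
  rewrite deriveE // -[s in LHS]mulr1 -[s * 1]/(s *: (1 : R)) linearZ /=.
  by rewrite -deriveE // pE powR1 mulr1.
move: ps; rewrite /derivable => /cvg_ex[l hl].
have El : l = s * p by rewrite -Es; apply/esym/cvg_lim.
rewrite El in hl.
apply: cvg_trans (cvg_dnbhs_at_right hl).
apply: near_eq_cvg; apply: nearW => t /=.
by rewrite powR1 mulrC [t *: s]mulrC [s * t + 1]addrC.
Qed.

(** Up to an error [L * t * `|x - y|] the increment of [F] from [y] to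
    [y + t s x] is the one from [y] to [(1 + t s) y], which homogeneity
    computes; the error divided by [t] vanishes as [y] tends to [x]. *)
Lemma clarke_euler F (p s : R) x : homogeneous p F -> locally_lipschitz F ->
  (clarke_derivative F x (s *: x) <= (s * p * F x)%:E)%E.
Proof.
move=> Fh Fl; have cF := locally_lipschitz_continuous Fl.
have [U [L [xU L0 UL]]] := locally_lipschitzP x Fl.
pose Phi := filter_prod (nbhs x) (0 : R)^'+.
have c1 : (fun z : 'rV[R]_n * R => z.1) @ Phi --> x by exact: cvg_fst.
have c2 : (fun z : 'rV[R]_n * R => z.2) @ Phi --> (0 : R)^'+ by exact: cvg_snd.
have c20 : (fun z : 'rV[R]_n * R => z.2) @ Phi --> (0 : R).
  exact: cvg_trans c2 at_right0_cvg0.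
apply: (clarke_cvg_le (b := fun z => ((1 + s * z.2) `^ p - 1) / z.2 * F z.1 +
  L * (`|s| * `|x - z.1|))); last first.
  rewrite -[X in _ --> X]addr0; apply: cvgD.
    apply: cvgM.
      apply: (cvg_comp _ (fun t : R => ((1 + s * t) `^ p - 1) / t) c2).
      exact: powR_slope_cvg.
    exact: (cvg_comp _ F c1 (cF x)).
  rewrite -[X in _ --> X](mulr0 L); apply: cvgM; first exact: cvg_cst.
  rewrite -[X in _ --> X](mulr0 `|s|); apply: cvgM; first exact: cvg_cst.
  rewrite -[X in _ --> X](@normr0 R 'rV[R]_n); apply: cvg_norm.
  by rewrite -(subrr x); apply: cvgB => //; exact: cvg_cst.
have near1 : \forall z \near Phi, U (z.1 + z.2 *: (s *: x)).
  have : (fun z : 'rV[R]_n * R => z.1 + z.2 *: (s *: x)) @ Phi --> x.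
    rewrite -[X in _ --> X]addr0; apply: cvgD => //.
    by rewrite -(scale0r (s *: x)); apply: cvgZ => //; exact: cvg_cst.
  by apply.
have c3 : (fun z : 'rV[R]_n * R => 1 + s * z.2) @ Phi --> (1 : R).
  rewrite -[X in _ --> X]addr0; apply: cvgD; first exact: cvg_cst.
  by rewrite -[X in _ --> X](mulr0 s); apply: cvgM => //; exact: cvg_cst.
have near2 : \forall z \near Phi, U ((1 + s * z.2) *: z.1).
  have : (fun z : 'rV[R]_n * R => (1 + s * z.2) *: z.1) @ Phi --> x.
    by rewrite -[X in _ --> X]scale1r; apply: cvgZ.
  by apply.
have near3 : \forall z \near Phi, 0 < 1 + s * z.2.
  exact: (c3 _ (lt_nbhsr (@ltr01 R))).
have near4 : \forall z \near Phi, 0 < z.2.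
  exact: (c2 _ (nbhs_right_gt (0 : R))).
near=> z.
have U1 : U (z.1 + z.2 *: (s *: x)) by near: z.
have U2 : U ((1 + s * z.2) *: z.1) by near: z.
have z3 : 0 < 1 + s * z.2 by near: z.
have z4 : 0 < z.2 by near: z.
rewrite ler_pdivrMr // mulrDl.
have -> : ((1 + s * z.2) `^ p - 1) / z.2 * F z.1 * z.2 =
    F ((1 + s * z.2) *: z.1) - F z.1.
  by rewrite Fh //; field; rewrite gt_eqF.
have := le_trans (ler_norm _) (UL _ _ U1 U2).
have -> : z.1 + z.2 *: (s *: x) - (1 + s * z.2) *: z.1 = (z.2 * s) *: (x - z.1).
  by apply/rowP => i; rewrite !mxE; ring.
rewrite normrZ normrM (gtr0_norm z4) => H.
have -> : L * (`|s| * `|x - z.1|) * z.2 = L * (z.2 * `|s| * `|x - z.1|) by ring.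
lra.
Unshelve. all: by end_near. Qed.

(** Euler's identity, from the two directions [x] and [- x]. *)
Lemma subdiff_euler F (p : R) x xi : homogeneous p F -> locally_lipschitz F ->
  subdiff F x xi -> dotv xi x = p * F x.
Proof.
move=> Fh Fl xiF; apply/eqP; rewrite eq_le; apply/andP; split.
  have := le_trans (xiF (1 *: x)) (clarke_euler 1 x Fh Fl).
  by rewrite lee_fin scale1r mul1r.
have := le_trans (xiF (-1 *: x)) (clarke_euler (-1) x Fh Fl).
by rewrite lee_fin scaleN1r dotvNr mulN1r mulNr lerN2.
Qed.

(** Along directions of invariance all difference quotients vanish. *)
Lemma subdiff_invariant F (Pi : {vspace 'rV[R]_n}) x xi :
    (forall y z, z \in Pi -> F (y + z) = F y) ->
  subdiff F x xi -> ortho_compl Pi xi.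
Proof.
move=> Finv xiF.
have le0 y : y \in Pi -> dotv xi y <= 0.
  move=> yPi; rewrite -lee_fin; apply: le_trans (xiF y) _; apply: clarke_le.
  by apply: nearW => z; rewrite Finv ?subrr ?mul0r // memvZ.
move=> y yPi; apply/eqP; rewrite eq_le le0 //=.
by rewrite -oppr_le0 -dotvNr le0 // memvN.
Qed.

End Clarke.

(** * Minimisation over the cosets of a subspace *)

Section Subspaces.
Variables (R : realType) (n : nat).
Local Notation V := 'rV[R]_n.

Lemma continuous_lincomb (W : normedModType R) (w : 'I_n -> W) :
  continuous (fun x : V => \sum_(i < n) x 0 i *: w i).
Proof.
apply: continuous_big => [|i _]; first exact: add_continuous.
move=> x; apply: (@continuousZr_tmp _ _ _ (fun x : V => x 0 i)).
exact: coord_continuous.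
Qed.

Lemma closed_vspace (U : {vspace V}) : closed [set` U].
Proof.
have -> : [set` U] = [set x : V | `|x - projv U x| <= 0].
  apply/seteqP; split => x /=.
    by move=> xU; rewrite projv_id // subrr normr0.
  by rewrite normr_le0 subr_eq0 => /eqP ->; exact: memv_proj.
apply: closed_sublevel => x.
have -> : (fun x : V => `|x - projv U x|) = Num.norm \o
    (fun x : V =>
       \sum_(i < n) x 0 i *: (delta_mx 0 i - projv U (delta_mx 0 i))).
  apply/funext => y; congr `| _ |; rewrite {1 2}[y]row_sum_delta linear_sum.
  rewrite -sumrB; apply: eq_bigr => i _; by rewrite linearZ -scalerBr.
apply: continuous_comp; last exact: norm_continuous.
exact: continuous_lincomb.
Qed.

Lemma compact_sphere : compact [set x : V | `|x| = 1].
Proof.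
apply: bounded_closed_compact.
  by exists 1; split => // r r1 x /= ->; exact: ltW.
have -> : [set x : V | `|x| = 1] = [set x | `|x| <= 1] `&` [set x | 1 <= `|x|].
  apply/seteqP; split => x /=; first by move=> ->.
  by move=> [x1 x2]; apply/eqP; rewrite eq_le x1.
by apply: closedI; [apply: closed_sublevel|apply: closed_superlevel];
  exact: norm_continuous.
Qed.

Variables (Pi : {vspace V}).

Definition coset_min (h : V -> R) z := forall y, y \in Pi -> h z <= h (z + y).

Section ConvexMin.
Variable h : V -> R.
Hypothesis h_cont : continuous h.
Hypothesis h_convex : forall (x y : V) (a b : R), 0 <= a -> 0 <= b ->
  a + b = 1 -> h (a *: x + b *: y) <= a * h x + b * h y.
Hypothesis h0 : h 0 = 0.
Hypothesis h_pos : forall x, x != 0 -> 0 < h x.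

(** Convexity and [h 0 = 0] make [h] grow at least linearly along rays from the
    unit sphere, where it has a positive minimum. *)
Lemma convex_coercive : exists2 c, 0 < c &
  forall z, 1 <= `|z| -> c * `|z| <= h z.
Proof.
have [S0|/nonemptyPn S0] := pselect ([set x : V | `|x| = 1] !=set0); last first.
  exists 1 => // z z1; exfalso.
  have z0 : `|z| != 0 by rewrite gt_eqF // (lt_le_trans ltr01).
  suff : [set x : V | `|x| = 1] (`|z|^-1 *: z) by rewrite S0.
  by rewrite /= normrZ normfV normr_id mulVf.
have [m] := compact_EVT_min S0 compact_sphere (continuous_subspaceT h_cont).
rewrite inE /= => m1 hm; exists (h m).
  by apply: h_pos; rewrite -normr_eq0 m1 oner_eq0.
move=> z z1; have z0 : 0 < `|z| by rewrite (lt_le_trans ltr01).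
rewrite -ler_pdivlMr //.
have u1 : `|z|^-1 *: z \in [set x : V | `|x| = 1].
  by rewrite inE /= normrZ normfV normr_id mulVf // gt_eqF.
apply: le_trans (hm _ u1) _.
have := @h_convex z 0 `|z|^-1 (1 - `|z|^-1).
rewrite scaler0 addr0 h0 mulr0 addr0 mulrC; apply; last by rewrite addrC subrK.
  by rewrite invr_ge0 ltW.
by rewrite subr_ge0 invf_le1.
Qed.

Lemma coset_min_exists x : exists2 y, y \in Pi & coset_min h (x + y).
Proof.
have [c c0 hc] := convex_coercive.
pose B := [set z : V | z - x \in Pi] `&` [set z | h z <= h x].
have clB : closed B.
  apply: closedI; last exact: closed_sublevel.
  rewrite -[X in closed X]/((fun z : V => z - x) @^-1` [set` Pi]).
  apply: preimage_closed; last exact: closed_vspace.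
  move=> z _.
  by apply: continuousB => //; exact: cst_continuous.
have bB : bounded_set B.
  exists (Num.max 1 (h x / c)); split; first exact: num_real.
  move=> r; rewrite gt_max => /andP[r1 rx] z [_ /= zx].
  have [z1|/ltW z1] := leP 1 `|z|; last exact: le_trans z1 (ltW r1).
  apply: le_trans (ltW rx); rewrite ler_pdivlMr // mulrC.
  exact: le_trans (hc z z1) zx.
have B0 : B !=set0 by exists x; split => //=; rewrite subrr mem0v.
have [m] := compact_EVT_min B0 (bounded_closed_compact bB clB)
  (continuous_subspaceT h_cont).
rewrite inE => -[/= mPi mx] hm; exists (m - x) => //.
rewrite addrC subrK => y yPi.
have [le_x|/ltW gt_x] := leP (h (m + y)) (h x); last exact: le_trans mx gt_x.
by apply: hm; rewrite inE; split => //=; rewrite addrAC memvD.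
Qed.

Lemma coset_min_notin z : z != 0 -> coset_min h z -> z \notin Pi.
Proof.
move=> z0 zmin; apply/negP => zPi.
have := zmin (- z); rewrite memvN subrr h0 => /(_ zPi).
by rewrite leNgt h_pos.
Qed.

Lemma subgradient_coset_min z xi :
  subgradient h z xi -> ortho_compl Pi xi -> coset_min h z.
Proof. by move=> hz xiPi y yPi; have := hz y; rewrite xiPi // addr0. Qed.

(** The marginal function, that is the minimum of [h] over cosets of [Pi], is
    convex, lies below [h] and agrees with [h] at [z], so its subgradients at
    [z] are subgradients of [h]; they are orthogonal to [Pi] because the
    marginal function is constant on cosets. *)
Lemma coset_min_subgradient z : coset_min h z ->
  exists2 xi, subgradient h z xi & ortho_compl Pi xi.
Proof.
move=> zmin.
have /choice[r rP] : forall x, exists y, y \in Pi /\ coset_min h (x + y).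
  by move=> x; have [y] := coset_min_exists x; exists y.
pose M x := h (x + r x).
have M_le x y : y \in Pi -> M x <= h (x + y).
  move=> yPi; have [rPi rmin] := rP x.
  have -> : x + y = x + r x + (y - r x) by rewrite -addrA [r x + _]addrC subrK.
  by apply: rmin; rewrite memvB.
have M_convex (x y : V) (a b : R) : 0 <= a -> 0 <= b ->
    a + b = 1 -> M (a *: x + b *: y) <= a * M x + b * M y.
  move=> a0 b0 ab1; apply: le_trans (h_convex _ _ a0 b0 ab1).
  rewrite !scalerDr addrACA; apply: M_le.
  by have [? _] := rP x; have [? _] := rP y; rewrite memvD // memvZ.
have Mz : M z = h z.
  apply/eqP; rewrite eq_le; apply/andP; split; last first.
    by apply: zmin; case: (rP z).
  by have := M_le z 0; rewrite addr0 mem0v => ->.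
have [xi xiP] := subgradient_exists M_convex z.
exists xi => [v|].
  rewrite -Mz; apply: le_trans (xiP v) _.
  by have := M_le (z + v) 0; rewrite addr0 mem0v => ->.
have le0 y : y \in Pi -> dotv xi y <= 0.
  move=> yPi; rewrite -(lerD2l (M z)) addr0; apply: le_trans (xiP y) _.
  have -> : M z = h (z + y - y) by rewrite addrK.
  by apply: M_le; rewrite memvN.
move=> y yPi; apply/eqP; rewrite eq_le le0 //=.
by rewrite -oppr_le0 -dotvNr le0 // memvN.
Qed.

End ConvexMin.

(** The orthogonal projection as the coset minimiser of the squared length. *)
Lemma ortho_decomposition x : exists2 y, y \in Pi & ortho_compl Pi (x + y).
Proof.
pose q (z : V) := dotv z z.
have q_cont : continuous q.
  apply: continuous_fsum => i z.
  by apply: continuousM; exact: coord_continuous.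
have q_convex (u v : V) (a b : R) : 0 <= a -> 0 <= b ->
    a + b = 1 -> q (a *: u + b *: v) <= a * q u + b * q v.
  move=> a0 b0 ab1; rewrite -subr_ge0.
  suff -> : a * q u + b * q v - q (a *: u + b *: v) = a * b * q (u - v).
    by rewrite mulr_ge0 ?mulr_ge0 // dotv_ge0.
  have -> : b = 1 - a by rewrite -ab1 addrC addKr.
  rewrite /q !(dotvDl, dotvDr, dotvNl, dotvNr, dotvZl, dotvZr) [dotv v u]dotvC.
  by ring.
have [||y yPi ymin] := coset_min_exists q_cont q_convex _ _ x.
- exact: dotv0r.
- exact: dotv_gt0.
exists y => // w wPi; move: (x + y) ymin => z ymin.
have [->|w0] := eqVneq w 0; first exact: dotv0r.
have b0 : 0 < dotv w w by exact: dotv_gt0.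
(* This multiple of w minimises the squared length on the line z + R w. *)
have := ymin ((- (dotv z w / dotv w w)) *: w); rewrite memvZ // => /(_ isT).
rewrite /q !(dotvDl, dotvDr, dotvZl, dotvZr) [dotv w z]dotvC.
set a := dotv z w; set b := dotv w w; set c := dotv z z => H.
have b_neq0 : b != 0 by rewrite gt_eqF.
move: H; rewrite [X in _ <= X](_ : _ = c - a ^+ 2 / b); last by field.
rewrite lerDl oppr_ge0 pmulr_lle0 ?invr_gt0 // => a2.
by apply/eqP; rewrite -sqrf_eq0 eq_le a2 sqr_ge0.
Qed.

Lemma ortho_notin x : ortho_compl Pi x -> x != 0 -> x \notin Pi.
Proof.
move=> xPi x0; apply/negP => /xPi /eqP.
by rewrite dotv_eq0 (negbTE x0).
Qed.

End Subspaces.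

Section Homogeneous.
Variables (R : realType) (n : nat) (p : R).
Hypothesis p_gt0 : 0 < p.
Local Notation V := 'rV[R]_n.

Lemma homogeneous0 (F : V -> R) : homogeneous p F -> F 0 = 0.
Proof.
move=> Fh; have := Fh 0 2 (ltr0Sn R 1); rewrite scaler0.
have : 1 `^ p < 2 `^ p :> R.
  by apply: gt0_ltr_powR; rewrite ?nnegrE ?ltr1n.
rewrite powR1.
move: (2 `^ p) => c c1 H; have /eqP : (c - 1) * F 0 = 0.
  by rewrite mulrBl -H mul1r subrr.
by rewrite mulf_eq0 gt_eqF ?subr_gt0 //= => /eqP.
Qed.

Lemma homogeneous_quotient (F G : V -> R) x t :
  homogeneous p F -> homogeneous p G -> 0 < t ->
  F (t *: x) / G (t *: x) = F x / G x.
Proof.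
move=> Fh Gh t0; rewrite Fh // Gh // invfM mulrACA mulfV ?mul1r //.
by rewrite gt_eqF // powR_gt0.
Qed.

Lemma coset_minZ (Pi : {vspace V}) (G : V -> R) z t : homogeneous p G ->
  0 < t -> coset_min Pi G z -> coset_min Pi G (t *: z).
Proof.
move=> Gh t0 zmin y yPi.
have -> : t *: z + y = t *: (z + t^-1 *: y).
  by rewrite scalerDr scalerA mulfV ?scale1r // gt_eqF.
by rewrite !Gh // ler_wpM2l ?powR_ge0 // zmin // memvZ.
Qed.

(** The quotient has degree 0 and the coset minimal points form a closed cone,
    so it suffices to minimise over a compact part of the unit sphere. *)
Lemma quotient_min_exists (Pi : {vspace V}) (F G : V -> R) :
    Pi != fullv -> continuous F -> continuous G ->
    homogeneous p F -> homogeneous p G ->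
    (forall (x y : V) (a b : R), 0 <= a -> 0 <= b ->
      a + b = 1 -> G (a *: x + b *: y) <= a * G x + b * G y) ->
    (forall x, x != 0 -> 0 < G x) ->
  exists z, [/\ z != 0, coset_min Pi G z & forall w, w != 0 ->
    coset_min Pi G w -> F z / G z <= F w / G w].
Proof.
move=> Pi_proper cF cG Fh Gh Gc G_pos.
have G0 := homogeneous0 Gh.
pose A := [set z : V | `|z| = 1] `&` coset_min Pi G.
have normalized w : w != 0 -> coset_min Pi G w -> A (`|w|^-1 *: w).
  move=> w0 wmin; have w_gt0 : 0 < `|w| by rewrite normr_gt0.
  split; last by apply: coset_minZ => //; rewrite invr_gt0.
  by rewrite /= normrZ normfV normr_id mulVf // gt_eqF.
have A0 : A !=set0.
  have [x xPi] : exists x, x \notin Pi.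
    apply: contrapT => H; move/negP: Pi_proper; apply.
    rewrite eqEsubv subvf /=; apply/subvP => x _.
    by apply: contrapT => /negP xPi; apply: H; exists x.
  have [y yPi ymin] := coset_min_exists Pi cG Gc G0 G_pos x.
  exists (`|x + y|^-1 *: (x + y)); apply: normalized => //.
  by apply: contra xPi; rewrite addr_eq0 => /eqP ->; rewrite memvN.
have cA : compact A.
  apply: compact_closedI; first exact: compact_sphere.
  have -> : coset_min Pi G =
      \bigcap_(y in [set` Pi]) [set z | G z - G (z + y) <= 0].
    apply/seteqP; split => z zmin y yPi; first by rewrite /= subr_le0 zmin.
    by rewrite -subr_le0; exact: zmin.
  apply: closed_bigI => y _; apply: closed_sublevel => z.
  apply: continuousB; first exact: cG.
  apply: (continuous_comp (f := fun x : V => x + y)); last exact: cG.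
  by apply: continuousD => //; exact: cst_continuous.
have cQ : {within A, continuous (fun z => F z / G z)}.
  apply/subspace_continuousP => z [/= z1 _]; apply: cvg_within_filter.
  apply: cvgM; first exact: cF.
  apply: cvgV; last exact: cG.
  by rewrite gt_eqF // G_pos // -normr_eq0 z1 oner_eq0.
have [z] := compact_EVT_min A0 cA cQ.
rewrite inE => -[/= z1 zmin] zq; exists z; split => //.
  by rewrite -normr_eq0 z1 oner_eq0.
move=> w w0 wmin; rewrite -(homogeneous_quotient w Fh Gh (t := `|w|^-1)).
  by apply: zq; rewrite inE; exact: normalized.
by rewrite invr_gt0 normr_gt0.
Qed.

End Homogeneous.

(** * Sets of prescribed genus *)

Section Genus.
Variables (R : realType).

Lemma odd_map_normalize n s (A : set 'rV[R]_n) (g : 'rV[R]_n -> 'rV[R]_s) :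
    continuous g -> (forall x, A x -> g (- x) = - g x) ->
    (forall x, A x -> g x != 0) ->
  odd_map_to_sphere A s.
Proof.
move=> cg godd g0.
exists (fun x => (Num.sqrt (dotv (g x) (g x)))^-1 *: g x); split.
- apply/subspace_continuousP => x Ax; apply: cvg_within_filter.
  apply: cvgZ; last exact: cg.
  apply: cvgV; first by rewrite gt_eqF // sqrtr_gt0 dotv_gt0 // g0.
  apply: (continuous_comp (f := fun x => dotv (g x) (g x)));
    last exact: sqrt_continuous.
  move: x {Ax}; apply: continuous_fsum => i x.
  have cgi : {for x, continuous (fun x => g x 0 i)}.
    apply: (continuous_comp (f := g) (g := fun y : 'rV[R]_s => y 0 i)).
      exact: cg.
    exact: coord_continuous.
  exact: continuousM.
- by move=> x Ax; rewrite godd // dotvNl dotvNr opprK scalerN.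
- move=> x Ax; rewrite dotvZl dotvZr mulrA -invfM -expr2 sqr_sqrtr ?dotv_ge0 //.
  by rewrite mulVf // dotv_eq0 g0.
Qed.

Lemma genus_exists n (A : set 'rV[R]_n) k t : (0 < t)%N ->
    odd_map_to_sphere A t ->
    (forall s, odd_map_to_sphere A s -> (k <= s)%N) ->
  exists2 s, is_genus A s & (k <= s)%N.
Proof.
move=> t0 At Ak.
pose P s := (0 < s)%N && `[< odd_map_to_sphere A s >].
have exP : exists s, P s by exists t; rewrite /P t0 /=; apply/asboolP.
have [s /andP[s0 /asboolP As] smin] := ex_minnP exP.
exists s; last exact: Ak.
by split=> // r r0 Ar; apply: smin; rewrite /P r0; apply/asboolP.
Qed.

(** The set is the linear image of [cube_shell] in the span of [z] and [Pi]; the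
    Borsuk-Ulam theorem bounds its genus from below. *)
Lemma genus_family_span n (Pi : {vspace 'rV[R]_n}) z : z \notin Pi ->
  exists2 A, @genus_family R n (\dim Pi).+1 A &
    forall x, A x -> exists s y, y \in Pi /\ x = s *: z + y.
Proof.
move=> zPi; set d := \dim Pi.
pose X : d.+1.-tuple 'rV[R]_n := [tuple of z :: vbasis Pi].
have freeX : free X.
  by rewrite free_cons (span_basis (vbasisP Pi)) zPi (basis_free (vbasisP Pi)).
pose Phi (c : 'rV[R]_d.+1) : 'rV[R]_n := \sum_(i < d.+1) c 0 i *: X`_i.
have cPhi : continuous Phi.
  exact: (@continuous_lincomb R d.+1 'rV[R]_n (fun i : 'I_d.+1 => X`_i)).
have PhiN c : Phi (- c) = - Phi c.
  by rewrite -sumrN; apply: eq_bigr => i _; rewrite mxE scaleNr.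
have KN c : @cube_shell R d c -> cube_shell (- c).
  move=> [c1 c2]; split => [i|]; first by rewrite mxE normrN.
  by under eq_bigr do rewrite mxE normrN.
have Phi0 c : cube_shell c -> Phi c != 0.
  have /freeP fX := freeX.
  move=> [_ c1]; apply/eqP => /(fX (fun i => c 0 i)) c0.
  by move: c1; rewrite big1 ?ler10 // => i _; rewrite c0 normr0.
have A0 : ~ (Phi @` @cube_shell R d) 0.
  by move=> [c Kc c0]; move: (Phi0 c Kc); rewrite c0 eqxx.
have n0 : (0 < n)%N.
  case: n Pi z zPi @d X freeX Phi cPhi PhiN KN Phi0 A0 => // Pi z + *.
  have -> : z = 0 by apply/rowP; case.
  by rewrite mem0v.
exists (Phi @` @cube_shell R d); last first.
  move=> _ [c _ <-].
  exists (c 0 0), (\sum_(i < d) c 0 (lift ord0 i) *: (vbasis Pi)`_i).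
  split; last by rewrite /Phi big_ord_recl.
  apply: memv_suml => i _.
  by rewrite memvZ // vbasis_mem // mem_nth // size_tuple.
split => //.
- exists (Phi (axis R d 0)), (axis R d 0) => //.
  exact: (@fine_shell _ _ 0 0 [:: axis R d 0] _ _
    (mem_head _ _) (mem_head _ _)).
- apply: continuous_compact; first exact: continuous_subspaceT.
  exact: compact_cube_shell.
- apply/seteqP; split=> [_ [_ [c Kc <-] <-]|_ [c Kc <-]].
    by exists (- c); [exact: KN|rewrite PhiN].
  exists (- Phi c); last exact: opprK.
  by exists (- c); [exact: KN|rewrite PhiN].
- apply: (genus_exists n0).
    apply: (odd_map_normalize (g := id)) => [x|//|x Ax]; first exact: cvg_id.
    by apply/eqP => x0; apply: A0; rewrite -x0.
  move=> t [f [cf fodd f1]]; rewrite ltnNge; apply/negP => td.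
  have [||x Kx fx0] := @borsuk_ulam R d t (f \o Phi) td.
  + apply/subspace_continuousP => x Kx.
    have cfx : f @ within (Phi @` @cube_shell R d) (nbhs (Phi x)) --> f (Phi x).
      by move/subspace_continuousP: cf; apply; exists x.
    apply: cvg_trans cfx => U /= fU.
    have fUx : nbhs (Phi x) (fun y => (Phi @` @cube_shell R d) y -> U (f y)).
      exact: fU.
    have PhiU : nbhs (x : 'rV[R]_d.+1)
        (fun y : 'rV[R]_d.+1 =>
           (Phi @` @cube_shell R d) (Phi y) -> U (f (Phi y))).
      exact: cPhi x _ fUx.
    have : nbhs (x : 'rV[R]_d.+1)
        (fun y : 'rV[R]_d.+1 => cube_shell y -> U (f (Phi y))).
      by apply: filterS PhiU => y fy Ky; apply: fy; exists y.
    exact.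
  + by move=> x Kx /=; rewrite PhiN fodd //; exists x.
  + have AP : (Phi @` @cube_shell R d) (Phi x) by exists x.
    move: (f1 _ AP); rewrite -[f (Phi x)]/((f \o Phi) x) fx0 dotv0r => /eqP.
    by rewrite eq_sym oner_eq0.
Qed.

Section CosetMin.
Variables (n : nat) (Pi : {vspace 'rV[R]_n}) (G : 'rV[R]_n -> R).
Hypothesis G_cont : continuous G.
Hypothesis G_even : forall x, G (- x) = G x.
Hypothesis G_convex : forall (x y : 'rV[R]_n) (a b : R), 0 <= a -> 0 <= b ->
  a + b = 1 -> G (a *: x + b *: y) <= a * G x + b * G y.

Let gain (y x : 'rV[R]_n) : R := Num.max 0 (G x - G (x + y)).

Lemma continuous_drop y : continuous (fun x : 'rV[R]_n => G x - G (x + y)).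
Proof.
move=> x; apply: continuousB; first exact: G_cont.
apply: (continuous_comp (f := fun x : 'rV[R]_n => x + y)); last exact: G_cont.
by apply: continuousD => //; exact: cst_continuous.
Qed.

Lemma continuous_gain y : continuous (gain y).
Proof.
move=> x; have c0 : {for x, continuous (fun _ : 'rV[R]_n => 0 : R^o)}.
  exact: cst_continuous.
exact: (continuous_max c0 (@continuous_drop y x)).
Qed.

(** Otherwise every point [x] of [A] has a descent direction [y] in [Pi], one
    with [G (x + y) < G x].  Finitely many directions suffice by compactness;
    weighting them by their gains at [x] and subtracting the same expression at
    [- x] gives an odd continuous map to [Pi].  It has no zero on [A]: a
    subgradient of [G] at [x] is negative on every descent direction at [x], and
    the opposite of a descent direction at [- x] is one at [x].  Hence the genus
    of [A] is at most the dimension of [Pi]. *)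
Lemma genus_family_coset_min A : @genus_family R n (\dim Pi).+1 A ->
  exists2 x, A x & coset_min Pi G x.
Proof.
move=> [[a Aa] cA symA A0 [s [s1 As smin] sk]].
have AN x : A x -> A (- x) by move=> Ax; rewrite -symA; exists x.
apply: contrapT => noC.
have desc x : A x -> exists2 y, y \in Pi & G (x + y) < G x.
  move=> Ax; apply: contrapT => H; apply: noC; exists x => // y yPi.
  by rewrite leNgt; apply/negP => lty; apply: H; exists y.
have [d0|d0] := posnP (\dim Pi).
  have [y yPi] := desc a Aa; move: yPi.
  move/eqP: d0; rewrite dimv_eq0 => /eqP ->; rewrite memv0 => /eqP ->.
  by rewrite addr0 ltxx.
have [D DPi Acov] : exists2 D : {fset 'rV[R]_n}, {subset D <= [set` Pi]} &
    A `<=` cover [set` D] (fun y => [set x | G (x + y) < G x]).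
  move: cA; rewrite compact_cover; apply.
    move=> y _; rewrite openE => x /= xy; rewrite /interior.
    have : \forall t \near x, 0 < G t - G (t + y).
      have xy0 : 0 < G x - G (x + y) by rewrite subr_gt0.
      exact: (@continuous_drop y x _ (lt_nbhsr xy0)).
    by apply: filterS => t; rewrite subr_gt0.
  by move=> x /desc[y yPi xy]; exists y.
pose b := vbasis Pi.
pose c y x := gain y x - gain y (- x).
pose g x : 'rV[R]_(\dim Pi) := \row_i \sum_(y <- D) c y x * coord b i y.
suff : odd_map_to_sphere A (\dim Pi).
  by move=> /smin - /(_ d0); rewrite leqNgt sk.
apply: (odd_map_normalize (g := g)).
- move=> x; apply: continuous_rV => i.
  rewrite (_ : (fun y => g y 0 i) =
      (fun x => \sum_(y <- D) c y x * coord b i y)).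
    move: x; apply: continuous_big => [|y _ x]; first exact: add_continuous.
    apply: continuousM; last exact: cst_continuous.
    apply: continuousB; first exact: continuous_gain.
    apply: (continuous_comp (f := (-%R : 'rV[R]_n -> 'rV[R]_n)));
      last exact: continuous_gain.
    exact: opp_continuous.
  by apply/funext => y; rewrite mxE.
- move=> x _; apply/rowP => i; rewrite !mxE -sumrN; apply: eq_bigr => y _.
  by rewrite /c opprK -mulNr opprB.
- move=> x Ax; apply/eqP => gx0.
  have [xi xiG] := subgradient_exists G_convex x.
  have term_le0 y : c y x * dotv xi y <= 0.
    rewrite /c mulrBl subr_le0 /gain G_even -[- x + y]opprK opprD opprK G_even.
    have := xiG y; have := xiG (- y); rewrite dotvNr => H1 H2.
    case: (ltrP 0 (G x - G (x + y))) => [P1|N1];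
      case: (ltrP 0 (G x - G (x - y))) => [P2|N2].
    - nra.
    - rewrite mul0r; nra.
    - rewrite mul0r; nra.
    - by rewrite !mul0r.
  have [y0 y0D /= y0x] := Acov x Ax.
  have term_lt0 : c y0 x * dotv xi y0 < 0.
    rewrite /c /gain G_even -[- x + y0]opprK opprD opprK G_even.
    have := xiG y0; have := xiG (- y0); rewrite dotvNr => H1 H2.
    have P1 : 0 < G x - G (x + y0) by rewrite subr_gt0.
    rewrite (max_r (ltW P1)).
    case: (ltrP 0 (G x - G (x - y0))) => [P2|N2]; nra.
  have : \sum_(y <- D) c y x * dotv xi y < 0.
    rewrite (big_fsetD1 y0) //= -[ltRHS]addr0; apply: ltr_leD => //.
    by apply: sumr_le0.
  suff -> : \sum_(y <- D) c y x * dotv xi y = 0 by rewrite ltxx.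
  under eq_bigr do rewrite -dotvZr.
  rewrite -dotv_sumr (_ : \sum_(y <- D) _ = 0) ?dotv0r //.
  have -> : \sum_(y <- D) c y x *: y = \sum_(i < \dim Pi) g x 0 i *: b`_i.
    under [RHS]eq_bigr do rewrite mxE scaler_suml.
    rewrite exchange_big /= big_seq [RHS]big_seq; apply: eq_bigr => y yD.
    have yPi : y \in Pi by move: (DPi y yD) => /set_mem.
    rewrite {2}(coord_vbasis yPi) scaler_sumr.
    by apply: eq_bigr => i _; rewrite scalerA.
  by rewrite gx0 big1 // => i _; rewrite mxE scale0r.
Qed.

End CosetMin.
End Genus.

(** * The first nontrivial eigenvalue *)

Lemma convex_functionP (R : realType) (n : nat) (G : 'rV[R]_n -> R) :
  convex_function setT G ->
  forall (x y : 'rV[R]_n) (a b : R), 0 <= a -> 0 <= b ->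
  a + b = 1 -> G (a *: x + b *: y) <= a * G x + b * G y.
Proof.
move=> Gc x y a b a0 b0 ab1; have a1 : a <= 1 by rewrite -ab1 lerDl.
have := Gc (Itv01 a0 a1) x y (mem_set I) (mem_set I).
by have -> : b = 1 - a by rewrite -ab1 addrC addKr.
Qed.

Unset Implicit Arguments.

Theorem theorem2p1 (R : realType) (n : nat) (p : R) (F G : 'rV[R]_n -> R)
  (Pi : {vspace 'rV[R]_n})
  (p_gt0 : 0 < p)
  (F_ge0 : forall x, 0 <= F x)
  (G_ge0 : forall x, 0 <= G x)
  (F_lip : locally_lipschitz F)
  (G_lip : locally_lipschitz G)
  (F_even : forall x, F (- x) = F x)
  (G_even : forall x, G (- x) = G x)
  (F_hom : homogeneous p F)
  (G_hom : homogeneous p G)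
  (G_pos : forall x, x != 0 -> 0 < G x)
  (G_convex : convex_function setT G)
  (PiE : [set` Pi] = [set x | x != 0 /\ F x / G x = 0] `|` [set 0])
  (Pi_proper : Pi != fullv)
  (F_inv : forall x y, y \in Pi -> F (x + y) = F x) :
  exists (lambda : R) (maxq minG : 'rV[R]_n -> R),
    [/\ (forall x, (ortho_compl Pi `\ 0) x ->
           is_maximum [set F (x + y) / G (x + y) | y in [set` Pi]] (maxq x)) /\
        is_minimum [set maxq x | x in ortho_compl Pi `\ 0] lambda,
        (forall x, (ortho_compl Pi `\ 0) x ->
           is_minimum [set G (x + y) | y in [set` Pi]] (minG x)) /\
        is_minimum [set F x / minG x | x in ortho_compl Pi `\ 0] lambda,
        is_minimum [set F x / G x | x in
          [set x | x != 0 /\ subdiff G x `&` ortho_compl Pi !=set0]] lambda,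
        minmax_eigenvalue F G (\dim Pi).+1 = lambda%:E &
        is_minimum (spectrum F G `\ 0) lambda /\
        (Pi != 0%VS -> is_second_minimum (spectrum F G) lambda)].
Proof.
have cF := locally_lipschitz_continuous F_lip.
have cG := locally_lipschitz_continuous G_lip.
have Gc := convex_functionP G_convex.
have F0 := homogeneous0 p_gt0 F_hom.
have G0 := homogeneous0 p_gt0 G_hom.
have F_Pi x : x \in Pi -> F x = 0.
  by move=> xPi; rewrite -[x]add0r F_inv.
have F_pos x : x \notin Pi -> 0 < F x.
  move=> xPi; rewrite lt_neqAle F_ge0 andbT eq_sym.
  apply: contra xPi => /eqP Fx0.
  have [->|x0] := eqVneq x 0; first exact: mem0v.
  suff : [set` Pi] x by [].
  by rewrite PiE; left; split=> //; rewrite Fx0 mul0r.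
have [z [z0 zmin zle]] :=
  quotient_min_exists p_gt0 Pi_proper cF cG F_hom G_hom Gc G_pos.
set lambda := F z / G z in zle.
have zPi : z \notin Pi by exact: coset_min_notin G0 G_pos _ z0 zmin.
have lambda_gt0 : 0 < lambda by rewrite divr_gt0 // ?F_pos // G_pos.
have FzE : F z = lambda * G z by rewrite divfK // gt_eqF // G_pos.
have [xi xiG xiPi] := coset_min_subgradient cG Gc G0 G_pos zmin.
have /choice[r rP] : forall x, exists y, y \in Pi /\ coset_min Pi G (x + y).
  by move=> x; have [y] := coset_min_exists Pi cG Gc G0 G_pos x; exists y.
pose minG x := G (x + r x).
have minG_le x y : y \in Pi -> minG x <= G (x + y).
  move=> yPi; have [rPi rmin] := rP x.
  have -> : x + y = x + r x + (y - r x) by rewrite -addrA [r x + _]addrC subrK.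
  by apply: rmin; rewrite memvB.
have shift_neq0 x y : x \notin Pi -> y \in Pi -> x + y != 0.
  move=> xPi yPi; apply: contra xPi; rewrite addr_eq0 => /eqP ->.
  by rewrite memvN.
have minG_pos x : x \notin Pi -> 0 < minG x.
  by move=> xPi; rewrite G_pos // shift_neq0 //; case: (rP x).
have ortho_out x : (ortho_compl Pi `\ 0) x -> x \notin Pi.
  by move=> [xPi /eqP x0]; exact: ortho_notin.
pose maxq x := F x / minG x.
have maxq_ge x : (ortho_compl Pi `\ 0) x -> lambda <= maxq x.
  move=> /ortho_out xPi; have [rPi rmin] := rP x.
  by rewrite /maxq -(F_inv x _ rPi); apply: zle => //; exact: shift_neq0.
have [y yPi zyPi] := ortho_decomposition Pi z.
have zy0 : z + y != 0 by exact: shift_neq0.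
have maxq_zy : maxq (z + y) = lambda.
  rewrite /maxq F_inv //; congr (_ / _); apply/eqP; rewrite eq_le.
  apply/andP; split.
    by have := minG_le (z + y) (- y); rewrite addrK memvN => ->.
  have [rPi _] := rP (z + y).
  by rewrite /minG -addrA; apply: zmin; rewrite memvD.
have min_maxq : is_minimum [set maxq x | x in ortho_compl Pi `\ 0] lambda.
  split; first by exists (z + y) => //; split => //; exact/eqP.
  by move=> _ [x xPi <-]; exact: maxq_ge.
have spectrum_quotient mu x : x != 0 -> forall eta, subdiff G x eta ->
    subdiff F x (mu *: eta) -> mu = F x / G x.
  move=> x0 eta etaG etaF.
  have := subdiff_euler F_hom F_lip etaF.
  rewrite dotvZl (subdiff_euler G_hom G_lip etaG) mulrCA => /mulfI.
  by rewrite gt_eqF // => /(_ isT) <-; rewrite mulfK // gt_eqF // G_pos.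
have lambda_min : is_minimum (spectrum F G `\ 0) lambda.
  split.
    split; last by apply/eqP; rewrite gt_eqF.
    exists z => //; exists (lambda *: xi); split; last first.
      by exists xi => //; exact: subgradient_subdiff.
    (* lambda xi is a global subgradient of F at z: compare F with lambda G at
       the minimiser of G on the coset of z + v, where xi only sees v. *)
    apply: subgradient_subdiff => v; rewrite dotvZl FzE -mulrDr.
    have [wPi wmin] := rP (z + v).
    rewrite -(F_inv _ _ wPi).
    apply: le_trans (_ : lambda * G (z + v + r (z + v)) <= _).
      rewrite ler_pM2l //; have := xiG (v + r (z + v)).
      by rewrite dotvDr (xiPi _ wPi) addr0 addrA.
    have [->|w0] := eqVneq (z + v + r (z + v)) 0; first by rewrite G0 mulr0.
    by rewrite -ler_pdivlMr ?G_pos // zle.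
  move=> mu [[x x0 [zeta [zetaF [eta etaG etaE]]]] /eqP mu0].
  rewrite -etaE in zetaF.
  rewrite (spectrum_quotient _ _ x0 _ etaG zetaF); apply: zle => //.
  apply: (subgradient_coset_min (xi := eta)).
    exact: convex_subdiff_subgradient.
  move=> w wPi; have := subdiff_invariant F_inv zetaF wPi.
  by rewrite dotvZl => /eqP; rewrite mulf_eq0 (negbTE mu0) => /eqP.
exists lambda, maxq, minG; split.
- split=> // x xPi; have [rPi _] := rP x; split.
    by exists (r x) => //; rewrite F_inv.
  move=> _ [w wPi <-]; rewrite F_inv // ler_pM2l ?F_pos ?ortho_out //.
  rewrite lef_pV2 ?posrE; first exact: minG_le.
    by rewrite G_pos // shift_neq0 // ortho_out.
  by rewrite minG_pos // ortho_out.
- split=> // x xPi; have [rPi _] := rP x; split; first by exists (r x).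
  by move=> _ [w wPi <-]; exact: minG_le.
- split.
    exists z => //; split => //; exists xi; split => //.
    exact: subgradient_subdiff.
  move=> _ [x [x0 [eta [etaG etaPi]]] <-]; apply: zle => //.
  apply: subgradient_coset_min etaPi; exact: convex_subdiff_subgradient.
- apply/eqP; rewrite eq_le; apply/andP; split.
    have [A Agen AE] := genus_family_span zPi.
    apply: ge_ereal_inf; eexists; first by exists A.
    apply: ge_ereal_sup => _ [x Ax <-]; rewrite lee_fin.
    have x0 : x != 0.
      by apply/eqP => x0; case: Agen => _ _ _ + _; apply; rewrite -x0.
    have [s [w [wPi xE]]] := AE x Ax.
    have [s0|s_neq0] := eqVneq s 0.
      by rewrite xE s0 scale0r add0r F_Pi // mul0r ltW.
    have t0 : 0 < `|s| by rewrite normr_gt0.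
    have Gx : G (`|s| *: z) <= G x.
      have [s_ge0|s_lt0] := leP 0 s.
        rewrite ger0_norm // xE (coset_minZ G_hom _ zmin) //.
        by rewrite lt_neqAle eq_sym s_neq0.
      rewrite -[G x]G_even xE opprD -scaleNr -ltr0_norm //.
      by apply: (coset_minZ G_hom t0 zmin); rewrite memvN.
    have Fx : F x = F (`|s| *: z).
      rewrite xE F_inv //; have [s_ge0|s_lt0] := leP 0 s.
        by rewrite ger0_norm.
      by rewrite ltr0_norm // scaleNr F_even.
    rewrite Fx.
    apply: le_trans (_ : F (`|s| *: z) / G (`|s| *: z) <= _); last first.
      by rewrite (homogeneous_quotient z F_hom G_hom t0).
    rewrite ler_wpM2l // lef_pV2 // posrE G_pos //.
    by rewrite scaler_eq0 normr_eq0 negb_or s_neq0.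
  apply/ereal_infP => _ [A Agen <-].
  have [x Ax xmin] := genus_family_coset_min cG G_even Gc Agen.
  apply: le_ereal_sup_tmp; exists (F x / G x)%:E; first by exists x.
  rewrite lee_fin zle //; apply/eqP => x0.
  by case: Agen => _ _ _ + _; apply; rewrite -x0.
- split=> // Pi0; exists 0 => //; split.
    have xPi := memv_pick Pi.
    have x0 : vpick Pi != 0 by rewrite vpick0.
    exists (vpick Pi) => //; exists 0; split.
      by apply: subgradient_subdiff => v; rewrite dotv0l addr0 F_Pi.
    have [eta etaG] := subgradient_exists Gc (vpick Pi).
    by exists eta; [exact: subgradient_subdiff|rewrite scale0r].
  move=> mu [x x0 [zeta [zetaF [eta etaG etaE]]]]; rewrite -etaE in zetaF.
  by rewrite (spectrum_quotient _ _ x0 _ etaG zetaF) divr_ge0.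
Qed.
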